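(* Let $S$ be a disk with finitely many marked points on its boundary. There exists a natural map $$\mathbb{I}_{\mathcal A}^q:\mathcal{A}_0(\mathbb{Z}^t)\to\mathcal{O}_q(\mathcal{X})$$ which reduces to $\mathbb{I}_{\mathcal A}$ in the classical limit $q=1$. (The map is $l\mapsto M_{T_l}(\mathbf w)$ as described in the context; the assertion is that this element lies in $\mathcal{O}_q(\mathcal{X})$ and that for every ideal triangulation $T$, setting $q=1$ in its expression as a Laurent polynomial in the $X_{j;T}$ gives the expression of $\mathbb{I}_{\mathcal A}(l)$ in the classical coordinates $X_j$.)
   Context: **Combinatorics.** $S$ is a disk with finitely many marked points (at least three) on its boundary. An ideal triangulation $T$ is a triangulation of $S$ with vertices the marked points; $I$ is its set of edges (including boundary edges), $J$ the internal edges. For $i,j\in I$, $\varepsilon_{ij}$ is the sum over triangles $t$ of $T$ of $+1$ if $i,j$ are sides of $t$ and $i$ immediately follows $j$ counterclockwise about their common vertex in $t$, $-1$ if $j$ so follows $i$, $0$ otherwise. $\Lambda_T=(\lambda_{ij})_{i,j\in I}$: $\lambda_{ij}=1$ if $i,j$ share a vertex and $i$ is clockwise to $j$ there, $-1$ if $j$ is clockwise to $i$, $0$ otherwise; also write $\Lambda_T$ for the skew bilinear form on $\mathbb{Z}^I$ with $\Lambda_T(\mathbf e_i,\mathbf e_j)=\lambda_{ij}$. **Toric frames.** Let $\omega$ be a formal variable, $q=\omega^4$. There is a skew-field $\mathcal F$ (the fraction field of the skein algebra of $S$) and, for each $T$, a map $M_T:\mathbb{Z}^I\to\mathcal F\setminus\{0\}$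 with $M_T(0)=1$, $M_T(u)M_T(v)=\omega^{-\Lambda_T(u,v)}M_T(u+v)$, such that the elements $M_T(v)$ form a $\mathbb{Z}[\omega^{\pm1}]$-basis of a quantum torus whose skew-field of fractions is $\mathcal F$; and if $T'$ is obtained from $T$ by flipping $k$, then $M_{T'}(\mathbf e_i)=M_T(\mathbf e_i)$ for $i\ne k$ and $M_{T'}(\mathbf e_k)=M_T\big(-\mathbf e_k+\sum_i[\varepsilon_{ki}]_+\mathbf e_i\big)+M_T\big(-\mathbf e_k+\sum_i[-\varepsilon_{ki}]_+\mathbf e_i\big)$, $[a]_+=\max(a,0)$. These properties determine all $M_T$ from one of them; $M_T(\mathbf e_i)$ depends only on the arc $i$ (it is its class in the skein algebra). **Quantum Poisson variety.** For $j\in J$ put $X_{j;T}=M_T(\sum_s\varepsilon_{js}\mathbf e_s)$. They satisfy $X_iX_j=q^{2\varepsilon_{ij}}X_jX_i$ and transform under flips by the quantum mutation maps; thus the algebra $\mathcal X^q$ of rational functions on the quantum cluster Poisson variety (the gluing by quantum mutations of the skew-fields of fractions of the quantum tori over $\mathbb{Z}[q^{\pm1}]$ with generators $X_j^{\pm1}$, $j\in J$, and these relations) is identified with the subfield of $\mathcal F$ generated by the $X_{j;T}$. $\mathcal{O}_q(\mathcal X)$ is the set of elements which, for every $T$, are Laurent polynomials in the $X_{j;T}$ with coefficients in $\mathbb{Z}[q,q^{-1}]$. **Laminations.** $\mathcal{A}_0(\mathbb{Z}^t)$ is the set of homotopy classes of finite collections of pairwise disjoint simple noncontractible arcs in $S$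 with endpoints in the interiors of boundary edges, with rational weights, nonnegative except possibly for special arcs (those cutting off exactly one marked point), such that the total weight of ends on each boundary edge is $0$ and the coordinates $a_i=\frac12(\text{total weight of curves crossing edge } i\text{, minimally})$ are integers for all edges $i$ of a (any) $T$; arcs of weight 0 are discarded and homotopic arcs merged by adding weights. **The map.** Drag the endpoints of the arcs of $l$ counterclockwise along the boundary until they hit marked points; choose an ideal triangulation $T_l$ such that each resulting curve is an edge of it; let $\mathbf w$ be the integral vector with $w_i$ the weight of the curve at edge $i$. Put $\mathbb I^q_{\mathcal A}(l)=M_{T_l}(\mathbf w)$, independent of the choice of $T_l$. **Classical map.** $\mathbb I_{\mathcal A}(l)$ is the following regular function on the cluster Poisson variety: with marked points numbered $1,\dots,N$ counterclockwise, choose vectors $v_p\in\mathbb{C}^2$ at the marked points representing a configuration of points of $\mathbb{P}^1$; for an arc $pr$, $p<r$, let $A_{pr}=\det(v_p,v_r)$; then $\mathbb I_{\mathcal A}(l)=\prod_iA_i^{w_i}$ over edges $i$ of $T_l$, expressed in the coordinates $X_j=\prod_sA_s^{\varepsilon_{js}}$ ($j\in J$) for any triangulation $T$. *)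

(* Defs.v *)
From HB Require Import structures.
From mathcomp Require Import all_boot all_order all_algebra.
From mathcomp Require Import finmap.
From mathcomp Require Import reals complex.

Set Implicit Arguments.
Unset Strict Implicit.
Unset Printing Implicit Defensive.

Import Order.TTheory GRing.Theory Num.Theory.
Local Open Scope ring_scope.

(* The N marked points are the elements of 'I_N, numbered counterclockwise
   along the boundary circle.  In a disk, an arc between two distinct marked
   points is determined up to homotopy by its endpoints. *)
Definition ideal_arc (N : nat) : finType := {e : 'I_N * 'I_N | (e.1 < e.2)%N}.

Section Combinatorics.
Variable N : nat.
Implicit Types (i j k : ideal_arc N) (T : {set ideal_arc N}) (p r s : 'I_N).

Definition joins i p r : bool := (val i == (p, r)) || (val i == (r, p)).

(* The chords strictly interleave; chords sharing an endpoint do not cross. *)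
Definition cross i j : bool :=
  let: (p, r) := val i in let: (s, u) := val j in
  [&& p < s, s < r & r < u]%N || [&& s < p, p < u & u < r]%N.

Definition adjacent i : bool :=
  let: (p, r) := val i in ((r - p == 1) || (r - p == N.-1))%N.

(* An ideal triangulation of a polygon, given by its set I of edges (boundary
   edges included), is a maximal set of pairwise noncrossing arcs. *)
Definition ideal_triangulation T : bool :=
  maxset (fun E : {set ideal_arc N} => [forall i in E, forall j in E, ~~ cross i j]) T.

Definition boundary i : bool := adjacent i.
Definition internal T : {set ideal_arc N} := [set j in T | ~~ boundary j].

(* Number of steps counterclockwise along the boundary from p to r.  Seen from
   p, the arcs to p+1, p+2, ..., p+N-1 (mod N) follow each other
   counterclockwise. *)
Definition ccw_steps p r : nat := ((r + N - p) %% N)%N.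

(* i and j share a vertex p, at which i is clockwise to j. *)
Definition clockwise_to i j : bool :=
  [exists p, exists r, exists s,
    [&& joins i p r, joins j p s & (ccw_steps p r < ccw_steps p s)%N]].

Definition lambda i j : int :=
  if clockwise_to i j then 1 else if clockwise_to j i then - 1 else 0.

Definition side (t : {set 'I_N}) i : bool :=
  ((val i).1 \in t) && ((val i).2 \in t).

Definition triangles T : {set {set 'I_N}} :=
  [set t : {set 'I_N} | (#|t| == 3%N) && [forall i, side t i ==> (i \in T)]].

(* Two distinct sides of a triangle t are consecutive, inside t, at their
   common vertex: i immediately follows j counterclockwise there exactly when
   j is clockwise to i. *)
Definition eps T i j : int :=
  \sum_(t in triangles T | side t i && side t j)
    (if clockwise_to j i then 1 else if clockwise_to i j then - 1 else 0).

(* Z^I, for I the set of edges of T, is the set of integral vectors indexed by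
   all arcs that are supported on T. *)
Definition vec := {ffun ideal_arc N -> int}.
Definition supported T (v : vec) : Prop := forall i, v i != 0 -> i \in T.

Definition basis_vec i : vec := [ffun j => (j == i)%:R].

Definition Lambda T (u v : vec) : int :=
  \sum_(i in T) \sum_(j in T) u i * lambda i j * v j.

(* T' is obtained from T by flipping k, which is replaced by k'. *)
Definition flip T k k' T' : Prop :=
  [/\ k \in internal T, k' \notin T, T' = k' |: (T :\ k)
    & ideal_triangulation T'].

Definition pos_part (a : int) : int := Num.max a 0.

(* The exponents - e_k + sum_i [c * eps_ki]_+ e_i, for c = 1 and c = -1. *)
Definition flip_vec T k (c : int) : vec :=
  - basis_vec k + \sum_(i in T) basis_vec i *~ pos_part (c * eps T k i).

Definition X_vec T j : vec := \sum_(s in T) basis_vec s *~ eps T j s.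

(* Finitely supported families f (v, n) of integers, encoding the Laurent
   polynomials sum f (v, n) z^n x^v over Z[z, z^-1]. *)
Definition laurent := {fsfun vec * int -> int with 0}.

End Combinatorics.

Section Quantum.
Variables (N : nat) (F : unitRingType) (omega : F).
Variable M : {set ideal_arc N} -> vec N -> F.
Implicit Types (T : {set ideal_arc N}) (f L : laurent N).

Definition torus_eval T f : F :=
  \sum_(m <- finsupp f) (f m)%:~R * omega ^ m.2 * M T m.1.

Definition torus_supported T f : Prop :=
  forall m, m \in finsupp f -> supported T m.1.

(* F is meant to be a skew-field (GRing.field_axiom F).  Since M_T(0) = 1,
   [tf_free] says in particular that omega is transcendental over Z. *)
Record toric_frames : Prop := ToricFrames {
  tf_central : forall x : F, omega * x = x * omega;
  tf_neq0 : forall T v, ideal_triangulation T -> supported T v -> M T v != 0;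
  tf_zero : forall T, ideal_triangulation T -> M T 0 = 1;
  tf_mul : forall T u v, ideal_triangulation T ->
    supported T u -> supported T v ->
    M T u * M T v = omega ^ (- Lambda T u v) * M T (u + v);
  tf_free : forall T f, ideal_triangulation T -> torus_supported T f ->
    torus_eval T f = 0 -> finsupp f = fset0;
  tf_frac : forall T (x : F), ideal_triangulation T ->
    exists f g, [/\ torus_supported T f, torus_supported T g,
      torus_eval T g != 0 & x = torus_eval T f / torus_eval T g];
  tf_arc : forall T T' i, ideal_triangulation T -> ideal_triangulation T' ->
    i \in T -> i \in T' -> M T (basis_vec i) = M T' (basis_vec i);
  tf_flip : forall T T' k k', ideal_triangulation T -> flip T k k' T' ->
    M T' (basis_vec k') = M T (flip_vec T k 1) + M T (flip_vec T k (-1))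
}.

Definition qX T (j : ideal_arc N) : F := M T (X_vec T j).

Definition qparam : F := omega ^+ 4.

(* The generators X_j commute up to powers of q, so that the Laurent
   polynomials in them are the combinations of monomials in which the factors
   come in one fixed order. *)
Definition qX_eval T L : F :=
  \sum_(m <- finsupp L)
    (L m)%:~R * qparam ^ m.2 * \prod_(j in internal T) qX T j ^ m.1 j.

(* The rational functions on the quantum cluster Poisson variety, as the
   sub-skew-field of F generated by the X_{j;T} over Z[q, q^-1]. *)
Definition in_Xq (x : F) : Prop :=
  forall K : {pred F}, GRing.divring_closed K -> qparam \in K ->
    (forall T j, ideal_triangulation T -> j \in internal T -> qX T j \in K) ->
    x \in K.

Definition in_Oq (x : F) : Prop :=
  in_Xq x /\ forall T, ideal_triangulation T -> exists L, x = qX_eval T L.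

End Quantum.

Section Laminations.
Variable N : nat.

(* Homotopy classes of simple noncontractible arcs with endpoints in the
   interiors of boundary edges are pairs of distinct boundary edges.  The
   boundary edge labelled e is the one running counterclockwise from the marked
   point e-1 (mod N) to the marked point e. *)
Definition curve : finType := ideal_arc N.
Implicit Types (c d : curve).

Definition curve_end c (e : 'I_N) : bool := (e == (val c).1) || (e == (val c).2).

(* The curve from edge e to edge f, e < f, separates the f - e marked points
   e, ..., f-1 from the N - (f - e) others. *)
Definition special c : bool := adjacent c.

(* The boundary edges p+1, ..., r lie on one side of the arc joining the marked
   points p < r, and the others lie on the other side. *)
Definition edge_side (i : ideal_arc N) (e : 'I_N) : bool :=
  ((val i).1 < e)%N && (e <= (val i).2)%N.

Definition crosses_edge (i : ideal_arc N) c : bool :=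
  edge_side i (val c).1 != edge_side i (val c).2.

(* If i is a boundary edge, the curves with an end on i are those counted. *)
Definition a_coord (wt : curve -> rat) (i : ideal_arc N) : rat :=
  2^-1 * \sum_(c | crosses_edge i c) wt c.

(* A_0(Z^t).  After merging homotopic curves and discarding those of weight 0,
   a collection is a weight function on homotopy classes of curves.  Curves in
   given classes can be made disjoint, simultaneously, if and only if no two
   classes interleave. *)
Record lamination := Lamination {
  weight : {ffun curve -> rat};
  lam_disjoint : forall c d, weight c != 0 -> weight d != 0 -> ~~ cross c d;
  lam_ge0 : forall c, ~~ special c -> 0 <= weight c;
  lam_ends : forall e : 'I_N, \sum_(c | curve_end c e) weight c = 0;
  lam_int : exists2 T : {set ideal_arc N}, ideal_triangulation T
    & forall i, i \in T -> a_coord weight i \is a Num.int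
}.

(* Dragged counterclockwise, an endpoint on the boundary edge e first hits the
   marked point e; with the labels above this is the identity on pairs. *)
Definition drag c : ideal_arc N := c.

(* T and w are a possible choice of T_l, and the resulting vector w. *)
Definition adapted (l : lamination) (T : {set ideal_arc N}) (w : vec N) : Prop :=
  [/\ ideal_triangulation T,
      forall c, weight l c != 0 -> drag c \in T,
      supported T w
    & forall c, (w (drag c))%:~R = weight l c].

End Laminations.

Section Classical.
Variables (N : nat) (C : fieldType) (v : 'I_N -> 'cV[C]_2).

Definition A_coord (i : ideal_arc N) : C :=
  \det (row_mx (v (val i).1) (v (val i).2) : 'M[C]_2).

Definition cX (T : {set ideal_arc N}) (j : ideal_arc N) : C :=
  \prod_(s in T) A_coord s ^ eps T j s.

(* The specialization q = 1. *)
Definition cX_eval (T : {set ideal_arc N}) (L : laurent N) : C :=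
  \sum_(m <- finsupp L) (L m)%:~R * \prod_(j in internal T) cX T j ^ m.1 j.

Definition cI (T : {set ideal_arc N}) (w : vec N) : C :=
  \prod_(i in T) A_coord i ^ w i.

End Classical.

(* Main.v *)
Require Import Defs.
From HB Require Import structures.
From mathcomp Require Import all_boot all_order all_algebra.
From mathcomp Require Import finmap.
From mathcomp Require Import reals complex.
From mathcomp Require Import zify ring.

(* Give M_T(v) the degree that records, at each marked point p, the sum of the
   v_i over the arcs i ending at p.  For noncrossing arcs, lambda_ij is congruent
   mod 4 to the value at the degrees of e_i and e_j of one fixed form on degrees,
   sum_(p, s) d_p sgn(s - p) d'_s, which does not depend on any triangulation.
   So, up to an explicit power of omega depending only on degrees, homogeneous
   Laurent polynomials in M_T with coefficients in Z[omega^4, omega^-4] are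
   closed under products.  If pr crosses an arc ab of T, flipping ab in any
   triangulation containing the quadrilateral p, a, r, b is a quantum Ptolemy
   relation in which only ab has to be inverted; by induction on the number of
   crossings with T every arc is such a homogeneous Laurent polynomial, hence so
   is M_Tl(w), as w is nonnegative on internal arcs.  The vector w of a
   lamination has degree 0, and the vectors of degree 0 supported on T are
   exactly the integral combinations of the X-vectors, which pair to multiples
   of 4 under Lambda: this turns the expansion into a Laurent polynomial in the
   X_j over Z[q, q^-1].  Carrying the classical values along the same induction
   gives the limit q = 1, since the M_T(v) are linearly independent. *)

Set Implicit Arguments.
Unset Strict Implicit.
Unset Printing Implicit Defensive.

Import Order.TTheory GRing.Theory Num.Theory.
Local Open Scope ring_scope.

(** * Arcs and ideal triangulations *)

Section Arcs.
Variable N : nat.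
Implicit Types (i j k : ideal_arc N) (T : {set ideal_arc N}) (p r s : 'I_N).

Definition src i : 'I_N := (val i).1.
Definition tgt i : 'I_N := (val i).2.

Definition chord p r (h : (p < r)%N) : ideal_arc N :=
  exist (fun e : 'I_N * 'I_N => e.1 < e.2)%N (p, r) h.

Lemma src_lt_tgt i : (src i < tgt i)%N.
Proof. exact: (valP i). Qed.

Lemma src_chord p r (h : (p < r)%N) : src (chord h) = p.
Proof. by []. Qed.

Lemma tgt_chord p r (h : (p < r)%N) : tgt (chord h) = r.
Proof. by []. Qed.

Lemma arc_eqE i j :
  (i == j) = ((src i == src j :> nat) && (tgt i == tgt j :> nat)).
Proof. by []. Qed.

Lemma chordE i p r (h : (p < r)%N) : src i = p -> tgt i = r -> i = chord h.
Proof. by move=> si ti; apply/eqP; rewrite arc_eqE si ti !eqxx. Qed.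

Lemma crossE i j : cross i j =
  [&& src i < src j, src j < tgt i & tgt i < tgt j]%N ||
  [&& src j < src i, src i < tgt j & tgt j < tgt i]%N.
Proof. by rewrite /cross /src /tgt; case: (val i) (val j) => [? ?] [? ?]. Qed.

Lemma adjacentE i :
  adjacent i = ((tgt i - src i == 1) || (tgt i - src i == N.-1))%N.
Proof. by rewrite /adjacent /src /tgt; case: (val i). Qed.

Lemma sideE (t : {set 'I_N}) i : side t i = (src i \in t) && (tgt i \in t).
Proof. by []. Qed.

Lemma crossC i j : cross i j = cross j i.
Proof. by rewrite !crossE orbC. Qed.

Lemma cross_irr i : cross i i = false.
Proof. by rewrite crossE !ltnn. Qed.

(** One side of a boundary edge contains no marked point besides its endpoints, so no arc has an
    endpoint strictly on each side. *)
Lemma adjacent_cross i j : adjacent i -> ~~ cross i j.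
Proof.
rewrite adjacentE crossE.
have := src_lt_tgt i; have := src_lt_tgt j.
have := ltn_ord (tgt i); have := ltn_ord (tgt j); lia.
Qed.

Lemma tri_cross T i j :
  ideal_triangulation T -> i \in T -> j \in T -> ~~ cross i j.
Proof.
case/maxsetP => /forallP h _ iT jT; move: (h i).
by rewrite iT => /forallP/(_ j); rewrite jT.
Qed.

Definition noncrossing T := [forall i in T, forall j in T, ~~ cross i j].

Lemma noncrossingP T :
  reflect {in T &, forall i j, ~~ cross i j} (noncrossing T).
Proof.
apply: (iffP forall_inP) => [h i j iT jT|h i iT].
  by move/forall_inP: (h i iT); apply.
by apply/forall_inP => j jT; apply: h.
Qed.

Lemma triP T : reflect
  (noncrossing T /\ forall i, (forall j, j \in T -> ~~ cross i j) -> i \in T)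
  (ideal_triangulation T).
Proof.
apply: (iffP maxsetP) => [[h hmax]|[h hmax]]; split=> //.
  move=> i hi; rewrite -(hmax (i |: T)) ?setU11 ?subsetUr //.
  apply/noncrossingP => j k /setU1P[->|jT] /setU1P[->|kT].
  - by rewrite cross_irr.
  - exact: hi.
  - by rewrite crossC hi.
  - by move/noncrossingP: h; apply.
move=> E /noncrossingP hE sTE; apply/eqP; rewrite eqEsubset sTE andbT.
apply/subsetP => i iE; apply: hmax => j jT.
by apply: hE => //; apply: (subsetP sTE).
Qed.

Lemma tri_max T i : ideal_triangulation T ->
  (forall j, j \in T -> ~~ cross i j) -> i \in T.
Proof. by case/triP=> _; apply. Qed.

Lemma tri_adjacent T i : ideal_triangulation T -> adjacent i -> i \in T.
Proof. by move=> hT hi; apply: tri_max => // j _; apply: adjacent_cross. Qed.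

Lemma tri_ex T : noncrossing T ->
  {T' : {set ideal_arc N} | ideal_triangulation T' & T \subset T'}.
Proof. by move=> h; have [T' ? ?] := maxset_exists h; exists T'. Qed.

(** The third vertex of the triangle under [i] is the last neighbour of [src i] before [tgt i]: an
    arc of [T] that crosses the chord from there to [tgt i], but neither [i] nor the chord from
    [src i], must start at [src i] and end at a later neighbour. *)
Lemma inner_vertex T i : ideal_triangulation T -> i \in T ->
  (src i + 1 < tgt i)%N ->
  exists x : 'I_N, exists h1 : (src i < x)%N, exists h2 : (x < tgt i)%N,
    chord h1 \in T /\ chord h2 \in T.
Proof.
move=> hT iT li.
have lt1 : ((src i).+1 < N)%N by have := ltn_ord (tgt i); lia.
pose P (x : 'I_N) := [exists j in T, [&& src j == src i, tgt j == x & x < tgt i]%N].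
have hs : (src i < Ordinal lt1)%N by [].
have P1 : P (Ordinal lt1).
  apply/existsP; exists (chord hs); rewrite tri_adjacent //=; last first.
    by rewrite adjacentE src_chord tgt_chord /= subSnn eqxx.
  by rewrite src_chord tgt_chord !eqxx /=; lia.
case: (arg_maxnP (fun x : 'I_N => val x) P1) => x /existsP[j].
case/and3P => jT /eqP sj /andP[/eqP tj lx] xmax.
have ljx : (src i < x)%N by rewrite -sj -tj src_lt_tgt.
exists x, ljx, lx.
have Ej : j = chord ljx by apply: chordE.
split; first by rewrite -Ej.
apply: tri_max => // k kT; apply/negP => ck.
have := tri_cross hT iT kT; have := tri_cross hT jT kT.
move: ck; rewrite !crossE !src_chord !tgt_chord sj tj => ck nj ni.
have sk : src k = src i by apply: val_inj => /=; lia.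
have /xmax /= : P (tgt k).
  by apply/existsP; exists k; rewrite kT sk !eqxx /=; lia.
by move: ck; rewrite sk; lia.
Qed.

(* The triangle of [T] on the side of [i] containing the edge from [N-1] to
   [0] is found under the shortest arc of [T] that strictly covers [i]. *)
Lemma outer_vertex T i : ideal_triangulation T -> i \in T ->
  (tgt i - src i < N.-1)%N ->
  (exists x : 'I_N, exists h1 : (x < src i)%N, exists h2 : (x < tgt i)%N,
     chord h1 \in T /\ chord h2 \in T) \/
  (exists x : 'I_N, exists h1 : (tgt i < x)%N, exists h2 : (src i < x)%N,
     chord h1 \in T /\ chord h2 \in T).
Proof.
move=> hT iT li; have lst := src_lt_tgt i.
have lN := ltn_ord (tgt i).
have N0 : (0 < N)%N by lia.
have N1 : (N.-1 < N)%N by lia.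
have h0 : (Ordinal N0 < Ordinal N1)%N by rewrite /=; lia.
pose P j := (j \in T) && [&& src j <= src i, tgt i <= tgt j & j != i]%N.
have P0 : P (chord h0).
  rewrite /P tri_adjacent //=; last first.
    by rewrite adjacentE src_chord tgt_chord /= subn0 eqxx orbT.
  by rewrite arc_eqE src_chord tgt_chord /=; lia.
case: (arg_minnP (fun j => tgt j - src j)%N P0) => j.
case/andP => jT /and3P[sj tj nj] jmin.
have lj : (src j + 1 < tgt j)%N by move: nj; rewrite arc_eqE; lia.
(* As [i] crosses neither lower side of the triangle under [j], it lies under one of them, and
   minimality of [j] makes it that side. *)
have [x [h1 [h2 [c1 c2]]]] := inner_vertex hT jT lj.
have n1 := tri_cross hT iT c1; have n2 := tri_cross hT iT c2.
move: n1 n2; rewrite !crossE !src_chord !tgt_chord => n1 n2.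
have [xs|xs] := leqP x (src i).
  have [e|ne] := eqVneq (chord h2) i.
    left; exists (src j).
    have ex : src i = x by rewrite -e.
    have et : tgt i = tgt j by rewrite -e.
    have h1' : (src j < src i)%N by rewrite ex.
    have h2' : (src j < tgt i)%N by rewrite et; lia.
    exists h1', h2'; rewrite -(@chordE (chord h1) _ _ h1') ?c1 //.
    by rewrite -(@chordE j _ _ h2').
  have /jmin : P (chord h2) by rewrite /P c2 ne src_chord tgt_chord xs tj.
  by rewrite src_chord tgt_chord; lia.
have [xt|xt] := leqP (tgt i) x.
  have [e|ne] := eqVneq (chord h1) i.
    right; exists (tgt j).
    have ex : tgt i = x by rewrite -e.
    have es : src i = src j by rewrite -e.
    have h1' : (tgt i < tgt j)%N by rewrite ex.
    have h2' : (src i < tgt j)%N by rewrite es; lia.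
    exists h1', h2'; rewrite -(@chordE (chord h2) _ _ h1') ?c2 //.
    by rewrite -(@chordE j _ _ h2').
  have /jmin : P (chord h1) by rewrite /P c1 ne src_chord tgt_chord xt sj.
  by rewrite src_chord tgt_chord; lia.
by move: nj; rewrite arc_eqE; lia.
Qed.

(** The two triangles at [i] form a quadrilateral. Its vertices are listed in increasing order, so
    which diagonal [i] is depends on the position of the outer vertex. *)
Lemma internal_quad T i : ideal_triangulation T -> i \in internal T ->
  exists w x y z : 'I_N, exists (wx : (w < x)%N) (xy : (x < y)%N) (yz : (y < z)%N)
    (wz : (w < z)%N) (wy : (w < y)%N) (xz : (x < z)%N),
    [/\ chord wx \in T, chord xy \in T, chord yz \in T, chord wz \in T
      & i = chord wy \/ i = chord xz].
Proof.
move=> hT; rewrite inE => /andP[iT]; rewrite /boundary adjacentE => ni.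
have lst := src_lt_tgt i; have lN := ltn_ord (tgt i).
have li : (src i + 1 < tgt i)%N by lia.
have lo : (tgt i - src i < N.-1)%N by lia.
have [x [h1 [h2 [c1 c2]]]] := inner_vertex hT iT li.
have [[y [h3 [h4 [c3 c4]]]]|[y [h3 [h4 [c3 c4]]]]] := outer_vertex hT iT lo.
- have h5 : (y < x)%N by exact: ltn_trans h3 h1.
  exists y, (src i), x, (tgt i), h3, h1, h2, h4, h5, lst; split=> //.
  by right; apply: chordE.
- have h5 : (x < y)%N by exact: ltn_trans h2 h3.
  exists (src i), x, (tgt i), y, h1, h2, h3, h4, lst, h5; split=> //.
  by left; apply: chordE.
Qed.

(* The sides of the quadrilateral with diagonals [i] and any [k] in [T] crossing
   [i] cross only arcs of [T] that cross [i], and not [k]. *)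
Lemma arc_ind T (P : ideal_arc N -> Prop) : ideal_triangulation T ->
  (forall i, i \in T -> P i) ->
  (forall (w x y z : 'I_N) (wx : (w < x)%N) (xy : (x < y)%N) (yz : (y < z)%N)
    (wz : (w < z)%N) (wy : (w < y)%N) (xz : (x < z)%N),
    P (chord wx) -> P (chord xy) -> P (chord yz) -> P (chord wz) ->
    (chord wy \in T -> P (chord xz)) /\ (chord xz \in T -> P (chord wy))) ->
  forall i, P i.
Proof.
move=> hT hP hq i.
pose X i := [set j in T | cross i j].
have [n le_n] := ubnP #|X i|; elim: n i le_n => // n IHn i le_n.
have [/hP //|niT] := boolP (i \in T).
have [k kT ck] : exists2 k, k \in T & cross i k.
  apply/exists_inP; apply: contraR niT => /exists_inPn h.
  by apply: tri_max.
have IH j : (forall l, l \in T -> cross j l -> cross i l) -> ~~ cross j k -> P j.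
  move=> h nk; apply: IHn; rewrite -ltnS; apply: leq_trans le_n; rewrite ltnS.
  rewrite (cardsD1 k (X i)) inE kT ck ltnS subset_leq_card //.
  apply/subsetP => l; rewrite !inE => /andP[lT cl].
  by rewrite lT h // !andbT; apply: contraNneq nk => <-.
have Lk l : l \in T -> ~~ cross l k by move=> lT; apply: tri_cross hT lT kT.
have li := src_lt_tgt i; have lk := src_lt_tgt k.
have cE := crossE; move: (ck); rewrite crossE => /orP[]/and3P[c1 c2 c3].
  have c4 := ltn_trans (ltn_trans c1 c2) c3.
  have [||||_ h] := hq _ _ _ _ c1 c2 c3 c4 li lk.
  1-4: apply: IH => [l lT|]; rewrite ?cE ?src_chord ?tgt_chord; try lia.
  1-4: by have := Lk l lT; rewrite cE; lia.
  by rewrite (chordE li erefl erefl); apply: h; rewrite -(chordE lk erefl erefl).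
have c4 := ltn_trans (ltn_trans c1 c2) c3.
have [||||h _] := hq _ _ _ _ c1 c2 c3 c4 lk li.
1-4: apply: IH => [l lT|]; rewrite ?cE ?src_chord ?tgt_chord; try lia.
1-4: by have := Lk l lT; rewrite cE; lia.
by rewrite (chordE li erefl erefl); apply: h; rewrite -(chordE lk erefl erefl).
Qed.
End Arcs.

(** * Orientation of arcs and the exchange matrix *)

Section Clockwise.
Variable N : nat.
Implicit Types (i j k : ideal_arc N) (T : {set ideal_arc N}) (p r s : 'I_N).

Lemma joinsE i p r : joins i p r =
  (src i == p :> nat) && (tgt i == r :> nat) ||
  (src i == r :> nat) && (tgt i == p :> nat).
Proof. by rewrite /joins /src /tgt; case: (val i). Qed.

Lemma ccw_stepsE p r :
  ccw_steps p r = if (p <= r)%N then (r - p)%N else (r + N - p)%N.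
Proof.
have lp := ltn_ord p; have lr := ltn_ord r; rewrite /ccw_steps; case: leqP => h.
  have -> : (r + N - p = r - p + N)%N by lia.
  by rewrite modnDr modn_small //; lia.
by rewrite modn_small //; lia.
Qed.

(** Counterclockwise from [p], the labels above [p] come before those below it. The three cases are
    a common vertex that is the source of both arcs, the source of [i] and target of [j], or the
    target of both. *)
Lemma clockwiseE i j : clockwise_to i j =
  [|| (src i == src j :> nat) && (tgt i < tgt j)%N, src i == tgt j :> nat
    | (tgt i == tgt j :> nat) && (src i < src j)%N].
Proof.
have li := src_lt_tgt i; have lj := src_lt_tgt j.
have ti := ltn_ord (tgt i); have tj := ltn_ord (tgt j).
apply/existsP/idP.
  case=> p /existsP[r /existsP[s]]; rewrite !joinsE !ccw_stepsE.
  have := ltn_ord p; have := ltn_ord r; have := ltn_ord s.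
  by case: (leqP p r) => ?; case: (leqP p s) => ?; lia.
case/or3P => h; [exists (src i)|exists (src i)|exists (tgt i)].
- apply/existsP; exists (tgt i); apply/existsP; exists (tgt j).
  rewrite !joinsE !ccw_stepsE.
  by case: (leqP (src i) (tgt i)); case: (leqP (src i) (tgt j)); lia.
- apply/existsP; exists (tgt i); apply/existsP; exists (src j).
  rewrite !joinsE !ccw_stepsE.
  by case: (leqP (src i) (tgt i)); case: (leqP (src i) (src j)); lia.
- apply/existsP; exists (src i); apply/existsP; exists (src j).
  rewrite !joinsE !ccw_stepsE.
  by case: (leqP (tgt i) (src i)); case: (leqP (tgt i) (src j)); lia.
Qed.

Lemma lambdaC i j : lambda i j = - lambda j i.
Proof.
rewrite /lambda !clockwiseE.
have := src_lt_tgt i; have := src_lt_tgt j.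
by do ?case: ifP => ?; lia.
Qed.

Definition ord_sgn p s : int := (p < s)%N%:Z - (s < p)%N%:Z.

(** This is [degform] evaluated at the degrees of the basis vectors of [i] and [j]. *)
Definition end_sgn i j : int :=
  ord_sgn (src i) (src j) + ord_sgn (src i) (tgt j)
  + (ord_sgn (tgt i) (src j) + ord_sgn (tgt i) (tgt j)).

(** Without a common vertex, the four signs add up to 0 for nested arcs and to 4 or -4 for separated
    ones. With one common vertex the sum is [lambda i j], or minus three times it when a source
    meets a target. Crossing arcs would give 2 or -2. *)
Lemma lambda_mod4 i j : ~~ cross i j -> (4 %| end_sgn i j - lambda i j)%Z.
Proof.
rewrite /lambda /end_sgn /ord_sgn !clockwiseE crossE.
have := src_lt_tgt i; have := src_lt_tgt j.
by do ?case: ifP => ?; lia.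
Qed.

Lemma set3_third (t : {set 'I_N}) p r : #|t| = 3%N -> p != r ->
  p \in t -> r \in t -> exists2 x, x \notin [set p; r] & t = [set p; r; x].
Proof.
move=> ct npr pt rt.
have c1 : #|t :\ p :\ r| == 1%N.
  have := cardsD1 r (t :\ p); have := cardsD1 p t.
  by rewrite ct pt !inE (eq_sym r) npr rt /= !add1n => -[<-] -[<-].
have [x Ex] := cards1P c1.
have : x \in t :\ p :\ r by rewrite Ex set11.
rewrite !inE => /and3P[nr np xt].
exists x; first by rewrite !inE negb_or np nr.
rewrite -setUA [[set r; x]](_ : _ = r |: (t :\ p :\ r)) ?Ex //.
by rewrite -Ex setD1K ?setD1K // !inE rt andbT eq_sym.
Qed.

Lemma side_triangle p r s (pr : (p < r)%N) (rs : (r < s)%N) (ps : (p < s)%N) i :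
  side [set p; r; s] i = [|| i == chord pr, i == chord rs | i == chord ps].
Proof.
apply/idP/or3P; last by case=> /eqP->; rewrite sideE !inE !eqxx ?orbT.
rewrite sideE !inE => /andP[/orP[/orP[]|]/eqP si /orP[/orP[]|]/eqP ti];
  have := src_lt_tgt i; rewrite si ti => l; try by exfalso; clear -pr rs ps l; lia.
- by apply: Or31; apply/eqP; apply: chordE.
- by apply: Or33; apply/eqP; apply: chordE.
- by apply: Or32; apply/eqP; apply: chordE.
Qed.

Lemma triangle_in T p r s (pr : (p < r)%N) (rs : (r < s)%N) (ps : (p < s)%N) :
  chord pr \in T -> chord rs \in T -> chord ps \in T ->
  [set p; r; s] \in triangles T.
Proof.
move=> T1 T2 T3; rewrite inE -setUA cardsU1 cards2 !inE.
have -> : r != s by rewrite neq_ltn rs.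
have [npr nps] : p != r /\ p != s by rewrite !neq_ltn pr ps.
rewrite (negPf npr) (negPf nps) /=; apply/forallP => i; apply/implyP.
by rewrite setUA (side_triangle pr rs ps) => /or3P[]/eqP->.
Qed.

Lemma eps_two T i j (t1 t2 : {set 'I_N}) : t1 != t2 ->
  [set t in triangles T | side t i] = [set t1; t2] ->
  eps T i j = ((side t1 j)%:R + (side t2 j)%:R) *
    (if clockwise_to j i then 1 else if clockwise_to i j then - 1 else 0).
Proof.
move=> n12 E; rewrite /eps; set c := (if _ then _ else _).
transitivity (\sum_(t in [set t1; t2] | side t j) c).
  apply: eq_bigl => t; rewrite andbA -E !inE //.
rewrite big_mkcondr /= big_setU1 ?inE //= big_set1.
by rewrite mulrDl; congr (_ + _); case: side; rewrite ?mul1r ?mul0r.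
Qed.

Section Quad.
Variables (T : {set ideal_arc N}) (w x y z : 'I_N).
Variables (wx : (w < x)%N) (xy : (x < y)%N) (yz : (y < z)%N)
  (wz : (w < z)%N) (wy : (w < y)%N) (xz : (x < z)%N).
Hypotheses (hT : ideal_triangulation T) (Twx : chord wx \in T)
  (Txy : chord xy \in T) (Tyz : chord yz \in T) (Twz : chord wz \in T).

(** With a third vertex other than [x] and [z], a side of the triangle would cross a side of the
    quadrilateral. *)
Lemma triangles_wy : chord wy \in T ->
  [set t in triangles T | side t (chord wy)] = [set [set w; x; y]; [set w; y; z]].
Proof.
move=> Twy; apply/setP => t; rewrite !inE; apply/idP/idP; last first.
  case/orP => /eqP ->; rewrite sideE src_chord tgt_chord.
    by have := triangle_in Twx Txy Twy; rewrite !inE => ->; rewrite !eqxx !orbT.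
  by have := triangle_in Twy Tyz Twz; rewrite !inE => ->; rewrite !eqxx !orbT.
rewrite sideE src_chord tgt_chord => /andP[/andP[/eqP ct /forallP ht] /andP[wt yt]].
have nwy : w != y by rewrite neq_ltn wy.
have [u nu Et] := set3_third ct nwy wt yt.
have inT i : src i \in t -> tgt i \in t -> i \in T.
  by move=> h1 h2; apply: (implyP (ht i)); rewrite sideE h1.
have ut : u \in t by rewrite Et !inE eqxx orbT.
move: nu; rewrite !inE negb_or -!val_eqE /= => /andP[nuw nuy].
suff [eu|eu] : u = x \/ u = z.
- by rewrite Et eu setUAC eqxx.
- by rewrite Et eu eqxx orbT.
have nc i j : i \in T -> j \in T -> ~~ cross i j by exact: tri_cross.
have ltNge (p r : 'I_N) : p != r :> nat -> (p < r)%N \/ (r < p)%N by clear; lia.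
have [uw|wu] := ltNge _ _ nuw.
  have uy := ltn_trans uw wy.
  have := nc _ _ (inT (chord uy) ut yt) Twz; rewrite crossE !src_chord !tgt_chord.
  by move: uw wy yz; clear; lia.
have := inT (chord wu) wt ut => T1.
have [uy|yu] := ltNge _ _ nuy.
  have T2 := inT (chord uy) ut yt.
  have := nc _ _ T1 Txy; have := nc _ _ T2 Twx; rewrite !crossE !src_chord !tgt_chord.
  by move=> n1 n2; left; apply: val_inj => /=; clear -n1 n2 wu uy wx xy; lia.
have := nc _ _ T1 Tyz; have := nc _ _ (inT (chord yu) yt ut) Twz.
rewrite !crossE !src_chord !tgt_chord => n1 n2.
by right; apply: val_inj => /=; clear -n1 n2 yu wy yz; lia.
Qed.

Lemma triangles_xz : chord xz \in T ->
  [set t in triangles T | side t (chord xz)] = [set [set x; y; z]; [set w; x; z]].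
Proof.
move=> Txz; apply/setP => t; rewrite !inE; apply/idP/idP; last first.
  case/orP => /eqP ->; rewrite sideE src_chord tgt_chord.
    by have := triangle_in Txy Tyz Txz; rewrite !inE => ->; rewrite !eqxx !orbT.
  by have := triangle_in Twx Txz Twz; rewrite !inE => ->; rewrite !eqxx !orbT.
rewrite sideE src_chord tgt_chord => /andP[/andP[/eqP ct /forallP ht] /andP[xt zt]].
have nxz : x != z by rewrite neq_ltn xz.
have [u nu Et] := set3_third ct nxz xt zt.
have inT i : src i \in t -> tgt i \in t -> i \in T.
  by move=> h1 h2; apply: (implyP (ht i)); rewrite sideE h1.
have ut : u \in t by rewrite Et !inE eqxx orbT.
move: nu; rewrite !inE negb_or -!val_eqE /= => /andP[nux nuz].
suff [eu|eu] : u = y \/ u = w.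
- by rewrite Et eu setUAC eqxx.
- by rewrite Et eu [[set x; z; w]]setUC setUA eqxx orbT.
have nc i j : i \in T -> j \in T -> ~~ cross i j by exact: tri_cross.
have ltNge (p r : 'I_N) : p != r :> nat -> (p < r)%N \/ (r < p)%N by clear; lia.
have [ux|xu] := ltNge _ _ nux.
  have uz := ltn_trans ux xz.
  have := nc _ _ (inT (chord ux) ut xt) Twz; have := nc _ _ (inT (chord uz) ut zt) Twx.
  rewrite !crossE !src_chord !tgt_chord => n1 n2.
  by right; apply: val_inj => /=; clear -n1 n2 ux wx xz; lia.
have T1 := inT (chord xu) xt ut.
have [uz|zu] := ltNge _ _ nuz.
  have := nc _ _ T1 Tyz; have := nc _ _ (inT (chord uz) ut zt) Txy.
  rewrite !crossE !src_chord !tgt_chord => n1 n2.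
  by left; apply: val_inj => /=; clear -n1 n2 xu uz xy yz; lia.
have := nc _ _ T1 Twz; rewrite crossE !src_chord !tgt_chord.
by move: zu wx xz; clear; lia.
Qed.

(** The signs alternate around the quadrilateral: this is the row of the exchange matrix at [wy],
    and the opposite of the row at [xz]. *)
Definition quad_sgn i : int :=
  (i == chord wx)%:R + (i == chord yz)%:R - (i == chord xy)%:R - (i == chord wz)%:R.

Let ord_simpl := (eqxx, ltnn, ltn_eqF wx, gtn_eqF wx, ltn_eqF xy, gtn_eqF xy,
  ltn_eqF yz, gtn_eqF yz, ltn_eqF wz, gtn_eqF wz, ltn_eqF wy, gtn_eqF wy,
  ltn_eqF xz, gtn_eqF xz, leq_gtF (ltnW wx), leq_gtF (ltnW xy), leq_gtF (ltnW yz),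
  leq_gtF (ltnW wz),  leq_gtF (ltnW wy), leq_gtF (ltnW xz), wx, xy, yz, wz, wy, xz).

Lemma eps_wy i : chord wy \in T -> eps T (chord wy) i = quad_sgn i.
Proof.
move=> Twy; rewrite (eps_two _ _ (triangles_wy Twy)); last first.
  by apply/eqP => /setP/(_ x); rewrite !inE -!val_eqE /= !ord_simpl.
rewrite (side_triangle wx xy wy) (side_triangle wy yz wz) /quad_sgn.
have [->|n1] := eqVneq i (chord wx).
  by rewrite !clockwiseE ?arc_eqE !src_chord !tgt_chord /= !ord_simpl.
have [->|n2] := eqVneq i (chord xy).
  by rewrite !clockwiseE ?arc_eqE !src_chord !tgt_chord /= !ord_simpl.
have [->|n3] := eqVneq i (chord wy).
  by rewrite !clockwiseE ?arc_eqE !src_chord !tgt_chord /= !ord_simpl.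
have [->|n4] := eqVneq i (chord yz).
  by rewrite !clockwiseE ?arc_eqE !src_chord !tgt_chord /= !ord_simpl.
have [->|n5] := eqVneq i (chord wz).
  by rewrite !clockwiseE ?arc_eqE !src_chord !tgt_chord /= !ord_simpl.
by rewrite mul0r.
Qed.

Lemma eps_xz i : chord xz \in T -> eps T (chord xz) i = - quad_sgn i.
Proof.
move=> Txz; rewrite (eps_two _ _ (triangles_xz Txz)); last first.
  by apply/eqP => /setP/(_ y); rewrite !inE -!val_eqE /= !ord_simpl.
rewrite (side_triangle xy yz xz) (side_triangle wx xz wz) /quad_sgn.
have [->|n1] := eqVneq i (chord wx).
  by rewrite !clockwiseE ?arc_eqE !src_chord !tgt_chord /= !ord_simpl.
have [->|n2] := eqVneq i (chord xy).
  by rewrite !clockwiseE ?arc_eqE !src_chord !tgt_chord /= !ord_simpl.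
have [->|n3] := eqVneq i (chord xz).
  by rewrite !clockwiseE ?arc_eqE !src_chord !tgt_chord /= !ord_simpl.
have [->|n4] := eqVneq i (chord yz).
  by rewrite !clockwiseE ?arc_eqE !src_chord !tgt_chord /= !ord_simpl.
have [->|n5] := eqVneq i (chord wz).
  by rewrite !clockwiseE ?arc_eqE !src_chord !tgt_chord /= !ord_simpl.
by rewrite mul0r oppr0.
Qed.

End Quad.
End Clockwise.

(** * Exponent vectors and their degrees *)

Section Vectors.
Variable N : nat.
Implicit Types (i j k : ideal_arc N) (T : {set ideal_arc N}) (p r s : 'I_N).
Implicit Types (u v : vec N).

Lemma basis_vecE i j : basis_vec i j = (j == i)%:R.
Proof. by rewrite ffunE. Qed.

Lemma sum_basis_vec T (g : ideal_arc N -> int) (s : ideal_arc N) :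
  (\sum_(i in T) basis_vec i *~ g i) s = if s \in T then g s else 0.
Proof.
rewrite sum_ffunE; case: ifP => sT.
  rewrite (bigD1 s) //= ffunMzE basis_vecE eqxx intz big1 ?addr0 // => i /andP[_ ni].
  by rewrite ffunMzE basis_vecE eq_sym (negPf ni) mul0rz.
rewrite big1 // => i iT; rewrite ffunMzE basis_vecE.
by case: eqVneq => [e|_]; rewrite ?mul0rz //; rewrite e iT in sT.
Qed.

Lemma supported0 T : supported T 0.
Proof. by move=> i; rewrite ffunE eqxx. Qed.

Lemma supportedD T u v : supported T u -> supported T v -> supported T (u + v).
Proof.
move=> hu hv i; rewrite ffunE; have [e|/hu //] := eqVneq (u i) 0.
by rewrite e add0r => /hv.
Qed.

Lemma supportedN T u : supported T u -> supported T (- u).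
Proof. by move=> hu i; rewrite ffunE oppr_eq0 => /hu. Qed.

Lemma supported_basis T i : i \in T -> supported T (basis_vec i).
Proof.
by move=> iT s; rewrite basis_vecE; case: (eqVneq s i) => [-> //|_]; rewrite eqxx.
Qed.

Lemma supportedMz T u n : supported T u -> supported T (u *~ n).
Proof.
move=> hu i; rewrite ffunMzE => h; apply: hu; apply: contraNneq h => ->.
by rewrite mul0rz.
Qed.

Lemma supported_sum T (I : Type) (r : seq I) (P : pred I) (F : I -> vec N) :
  (forall a, P a -> supported T (F a)) ->
  supported T (\sum_(a <- r | P a) F a).
Proof.
move=> h; apply: (big_ind (supported T)) => //; first exact: supported0.
by move=> x y; apply: supportedD.
Qed.

Lemma supported_eq0 T u i : supported T u -> i \notin T -> u i = 0.
Proof. by move=> hu; apply: contraNeq; apply: hu. Qed.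

Lemma vec_sum_basis T u : supported T u -> u = \sum_(i in T) basis_vec i *~ u i.
Proof.
move=> hu; apply/ffunP => s; rewrite sum_basis_vec.
by case: ifP => // /negbT /(supported_eq0 hu).
Qed.

Lemma X_vec_supported T j : supported T (X_vec T j).
Proof.
by apply: supported_sum => i iT; apply/supportedMz/supported_basis.
Qed.

Definition deg u : {ffun 'I_N -> int} :=
  [ffun p => \sum_i u i * ((src i == p)%:R + (tgt i == p)%:R)].

Lemma degD u v : deg (u + v) = deg u + deg v.
Proof.
apply/ffunP => p; rewrite !ffunE -big_split /=; apply: eq_bigr => i _.
by rewrite ffunE mulrDl.
Qed.

Lemma deg0 : deg 0 = 0.
Proof. by apply: (@addIr _ (deg 0)); rewrite -degD !add0r. Qed.

Lemma degN u : deg (- u) = - deg u.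
Proof. by apply/eqP; rewrite -addr_eq0 -degD addNr deg0. Qed.

Lemma degMz u n : deg (u *~ n) = deg u *~ n.
Proof.
apply/ffunP => p; rewrite ffunMzE !ffunE mulrz_suml; apply: eq_bigr => i _.
by rewrite ffunMzE mulrzAl.
Qed.

Lemma deg_basis i p : deg (basis_vec i) p = (src i == p)%:R + (tgt i == p)%:R.
Proof.
rewrite ffunE (bigD1 i) //= basis_vecE eqxx mul1r big1 ?addr0 // => j nj.
by rewrite basis_vecE (negPf nj) mul0r.
Qed.

Lemma sum_deg u (g : 'I_N -> int) :
  \sum_p deg u p * g p = \sum_i u i * (g (src i) + g (tgt i)).
Proof.
under eq_bigr do rewrite ffunE mulr_suml.
rewrite exchange_big; apply: eq_bigr => i _ /=.
under eq_bigr do rewrite -mulrA mulrDl.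
rewrite -mulr_sumr; congr (_ * _); rewrite big_split /=.
have delta (q : 'I_N) : \sum_p (q == p)%:R * g p = g q.
  rewrite (bigD1 q) //= eqxx mul1r big1 ?addr0 // => p.
  by rewrite eq_sym => /negPf->; rewrite mul0r.
by rewrite !delta.
Qed.

Definition degform (d d' : {ffun 'I_N -> int}) : int :=
  \sum_p d p * \sum_s d' s * ord_sgn p s.

Lemma degform_deg u v :
  degform (deg u) (deg v) = \sum_i \sum_j u i * (v j * end_sgn i j).
Proof.
rewrite /degform sum_deg; apply: eq_bigr => i _.
rewrite !sum_deg -big_split mulr_sumr; apply: eq_bigr => j _.
by rewrite /= -mulrDr.
Qed.

Lemma degform0l d : degform 0 d = 0.
Proof. by rewrite /degform big1 // => p _; rewrite ffunE mul0r. Qed.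

(** Summing over all arcs makes the value visibly independent of the triangulation, which serves to
    compare two toric frames. *)
Lemma LambdaE T u v : supported T u -> supported T v ->
  Lambda T u v = \sum_i \sum_j u i * lambda i j * v j.
Proof.
move=> hu hv; rewrite /Lambda big_mkcond; apply: eq_bigr => i _.
have [iT|niT] := boolP (i \in T); last first.
  by rewrite big1 // => j _; rewrite (supported_eq0 hu niT) !mul0r.
rewrite big_mkcond; apply: eq_bigr => j _.
by have [//|njT] := boolP (j \in T); rewrite (supported_eq0 hv njT) !mulr0.
Qed.

Lemma Lambda_self T u : supported T u -> Lambda T u u = 0.
Proof.
move=> hu; rewrite LambdaE //; set S := \sum_i _.
suff : S = - S by lia.
rewrite {1}/S exchange_big /= -sumrN; apply: eq_bigr => i _.
rewrite -sumrN; apply: eq_bigr => j _.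
by rewrite lambdaC mulrN mulNr mulrAC [u j * _]mulrC mulrAC.
Qed.

Lemma dvdz_sum (I : Type) (r : seq I) (P : pred I) (F : I -> int) (d : int) :
  (forall a, P a -> (d %| F a)%Z) -> (d %| \sum_(a <- r | P a) F a)%Z.
Proof.
by move=> h; apply: (big_ind (fun x => (d %| x)%Z)) => // x y; apply: rpredD.
Qed.

Lemma Lambda_mod4 T u v : ideal_triangulation T ->
  supported T u -> supported T v ->
  (4 %| degform (deg u) (deg v) - Lambda T u v)%Z.
Proof.
move=> hT hu hv; rewrite LambdaE // degform_deg -sumrB.
apply: dvdz_sum => i _; rewrite -sumrB; apply: dvdz_sum => j _.
have [iT|niT] := boolP (i \in T); last first.
  by rewrite (supported_eq0 hu niT) !mul0r.
have [jT|njT] := boolP (j \in T); last first.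
  by rewrite (supported_eq0 hv njT) mul0r !mulr0.
have -> : u i * (v j * end_sgn i j) - u i * lambda i j * v j =
  u i * v j * (end_sgn i j - lambda i j) by ring.
by apply/dvdz_mull/lambda_mod4/(tri_cross hT).
Qed.

Section Quad.
Variables (T : {set ideal_arc N}) (w x y z : 'I_N).
Variables (wx : (w < x)%N) (xy : (x < y)%N) (yz : (y < z)%N)
  (wz : (w < z)%N) (wy : (w < y)%N) (xz : (x < z)%N).
Hypotheses (hT : ideal_triangulation T) (Twx : chord wx \in T)
  (Txy : chord xy \in T) (Tyz : chord yz \in T) (Twz : chord wz \in T).

Definition quad_vec : vec N :=
  basis_vec (chord wx) + basis_vec (chord yz)
  - (basis_vec (chord xy) + basis_vec (chord wz)).

Lemma quad_vecE i : quad_vec i = quad_sgn wx xy yz wz i.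
Proof. by rewrite /quad_sgn !ffunE opprD addrA. Qed.

Lemma quad_vec_supported : supported T quad_vec.
Proof.
apply: supportedD; last apply: supportedN;
  by apply: supportedD; apply: supported_basis.
Qed.

Lemma X_vec_wy : chord wy \in T -> X_vec T (chord wy) = quad_vec.
Proof.
move=> Twy; apply/ffunP => i; rewrite sum_basis_vec (eps_wy xz hT) //.
rewrite -quad_vecE; case: ifP => // /negbT niT.
by rewrite (supported_eq0 quad_vec_supported).
Qed.

Lemma X_vec_xz : chord xz \in T -> X_vec T (chord xz) = - quad_vec.
Proof.
move=> Txz; apply/ffunP => i; rewrite sum_basis_vec (eps_xz wy hT) //.
rewrite -quad_vecE; case: ifP => [_|/negbT niT]; first by rewrite [RHS]ffunE.
by rewrite [RHS]ffunE (supported_eq0 quad_vec_supported).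
Qed.

(** Each vertex of the quadrilateral lies on one side of sign 1 and one of sign -1. *)
Lemma deg_quad_vec : deg quad_vec = 0.
Proof.
apply/ffunP => p.
have e i := deg_basis i p.
move: (e (chord wx)) (e (chord yz)) (e (chord xy)) (e (chord wz)).
rewrite /quad_vec degD degN.
rewrite (degD (basis_vec (chord wx))) (degD (basis_vec (chord xy))).
(* The four degrees are generalized so that [ffunE] opens only the sums and opposites. *)
move: (deg _) (deg _) (deg _) (deg _) => a b c d ea eb ec ed.
rewrite !ffunE ea eb ec ed.
by rewrite !src_chord !tgt_chord; ring.
Qed.

Lemma pos_part_quad_sgn i :
  pos_part (quad_sgn wx xy yz wz i) = basis_vec (chord wx) i + basis_vec (chord yz) i.
Proof.
rewrite /pos_part /quad_sgn !basis_vecE !arc_eqE !src_chord !tgt_chord.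
by clear -wx xy yz; lia.
Qed.

Lemma pos_part_opp_quad_sgn i :
  pos_part (- quad_sgn wx xy yz wz i) = basis_vec (chord xy) i + basis_vec (chord wz) i.
Proof.
rewrite /pos_part /quad_sgn !basis_vecE !arc_eqE !src_chord !tgt_chord.
by clear -wx xy yz; lia.
Qed.

End Quad.
End Vectors.

(** * Vectors of degree zero *)

Section Span.
Variable N : nat.
Implicit Types (i j k c : ideal_arc N) (T : {set ideal_arc N}) (p r s : 'I_N).
Implicit Types (u v : vec N).

(** Strict nesting of arcs, away from the edge joining the last marked point to the first. It makes
    [T] a binary tree rooted at that edge, the children of an arc being the two lower sides of the
    triangle under it. *)
Definition under i c : bool :=
  [&& src c <= src i, tgt i <= tgt c & i != c]%N.

Lemma deg_X_vec T j : ideal_triangulation T -> j \in internal T ->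
  deg (X_vec T j) = 0.
Proof.
move=> hT jT; have : j \in T by case/setIdP: jT.
have [w [x [y [z [wx [xy [yz [wz [wy [xz]]]]]]]]]] := internal_quad hT jT.
case=> h1 h2 h3 h4 [->|->] h5.
  by rewrite (X_vec_wy xz hT h1 h2 h3 h4 h5) deg_quad_vec.
by rewrite (X_vec_xz wy hT h1 h2 h3 h4 h5) degN deg_quad_vec oppr0.
Qed.

(* In the last alternative, [i] is a side of the triangle on the other side of
   [c]. *)
Lemma X_vec_triangle T c : ideal_triangulation T -> c \in internal T ->
  exists x : 'I_N, exists h1 : (src c < x)%N, exists h2 : (x < tgt c)%N,
  [/\ chord h1 \in T, chord h2 \in T, X_vec T c (chord h1) = 1,
      X_vec T c (chord h2) = - 1
    & forall i, X_vec T c i != 0 -> [\/ i = chord h1, i = chord h2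
       | ~~ under i c /\ forall c' i', c' \in T -> under i c' -> under i' c ->
          under i' c']].
Proof.
move=> hT cT; have cT' : c \in T by case/setIdP: cT.
have [w [x [y [z [wx [xy [yz [wz [wy [xz]]]]]]]]]] := internal_quad hT cT.
case=> h1 h2 h3 h4 [] Ec; rewrite {c}Ec in cT cT' *.
  exists x, wx, xy; rewrite (X_vec_wy xz hT h1 h2 h3 h4 cT').
  split=> //; try by rewrite quad_vecE /quad_sgn !arc_eqE !src_chord !tgt_chord;
    clear -wx xy yz; lia.
  move=> i; rewrite quad_vecE /quad_sgn.
  have [->|_] := eqVneq i (chord wx); first by move=> _; apply: Or31.
  have [->|_] := eqVneq i (chord xy); first by move=> _; apply: Or32.
  move=> hi; apply: Or33; have {}hi : i = chord yz \/ i = chord wz.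
    have [->|n3] := eqVneq i (chord yz); first by left.
    have [->|n4] := eqVneq i (chord wz); first by right.
    by move: hi; rewrite (negPf n3) (negPf n4).
  split=> [|c' i' c'T].
    by rewrite /under arc_eqE src_chord tgt_chord; case: hi => ->;
      rewrite src_chord tgt_chord; clear -wx xy yz; lia.
  have := tri_cross hT c'T h4; have := tri_cross hT c'T cT'.
  rewrite !crossE /under !arc_eqE !src_chord !tgt_chord.
  by case: hi => ->; rewrite !src_chord !tgt_chord; clear -wx xy yz; lia.
exists y, xy, yz; rewrite (X_vec_xz wy hT h1 h2 h3 h4 cT').
have E i : (- quad_vec wx xy yz wz) i = - quad_sgn wx xy yz wz i.
  by rewrite [LHS]ffunE quad_vecE.
split=> //; try by rewrite E /quad_sgn !arc_eqE !src_chord !tgt_chord;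
  clear -wx xy yz; lia.
move=> i; rewrite E /quad_sgn.
have [->|_] := eqVneq i (chord xy); first by move=> _; apply: Or31.
have [->|_] := eqVneq i (chord yz); first by move=> _; apply: Or32.
move=> hi; apply: Or33; have {}hi : i = chord wx \/ i = chord wz.
  have [->|n3] := eqVneq i (chord wx); first by left.
  have [->|n4] := eqVneq i (chord wz); first by right.
  by move: hi; rewrite (negPf n3) (negPf n4).
split=> [|c' i' c'T].
  by rewrite /under arc_eqE src_chord tgt_chord; case: hi => ->;
    rewrite src_chord tgt_chord; clear -wx xy yz; lia.
have := tri_cross hT c'T h4; have := tri_cross hT c'T cT'.
rewrite !crossE /under !arc_eqE !src_chord !tgt_chord.
by case: hi => ->; rewrite !src_chord !tgt_chord; clear -wx xy yz; lia.
Qed.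

Lemma deg0_sum u p : deg u = 0 ->
  \sum_i u i * ((src i == p)%:R + (tgt i == p)%:R) = 0.
Proof. by move/ffunP/(_ p); rewrite !ffunE. Qed.

(** An arc of the support strictly under [c] is one of the two sides or lies under one, where [u]
    vanishes. An arc ending at [x] but not under [c] would cross [c], so the degree at [x] involves
    these two sides only. *)
Lemma under_children T u c (x : 'I_N) (h1 : (src c < x)%N) (h2 : (x < tgt c)%N) :
  ideal_triangulation T -> supported T u -> deg u = 0 -> c \in T ->
  chord h1 \in T -> chord h2 \in T ->
  (forall i, under i (chord h1) -> u i = 0) ->
  (forall i, under i (chord h2) -> u i = 0) ->
  u (chord h1) + u (chord h2) = 0 /\
  forall i, under i c -> u i != 0 -> i = chord h1 \/ i = chord h2.
Proof.
move=> hT hu du cT T1 T2 u1 u2; split; last first.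
  move=> i ic ui; have iT := hu i ui; have li := src_lt_tgt i.
  have x1 := tri_cross hT iT T1; have x2 := tri_cross hT iT T2.
  have x3 := tri_cross hT iT cT.
  have [->|n1] := eqVneq i (chord h1); first by left.
  have [->|n2] := eqVneq i (chord h2); first by right.
  case/negP: ui; apply/eqP.
  have [c1|c1] := boolP (under i (chord h1)); first exact: u1.
  have [c2|c2] := boolP (under i (chord h2)); first exact: u2.
  exfalso; move: ic n1 n2 c1 c2 x1 x2 x3.
  rewrite /under !arc_eqE !crossE !src_chord !tgt_chord.
  by clear -h1 h2 li; lia.
have := deg0_sum x du.
have n12 : chord h2 != chord h1.
  by rewrite arc_eqE !src_chord !tgt_chord; clear -h1 h2; lia.
rewrite (bigD1 (chord h1)) //= (bigD1 (chord h2)) //= !src_chord !tgt_chord !eqxx.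
have e1 : (src c == x) = false by rewrite -val_eqE /= (ltn_eqF h1).
have e2 : (tgt c == x) = false by rewrite -val_eqE /= (gtn_eqF h2).
rewrite e1 e2 add0r addr0 !mulr1 big1 ?addr0 // => i /andP[n1 n2].
have [e|ui] := eqVneq (u i) 0; first by rewrite e mul0r.
have iT := hu i ui; have li := src_lt_tgt i.
suff /andP[/negPf-> /negPf->] : (src i != x) && (tgt i != x) by rewrite addr0 mulr0.
have [c1|c1] := boolP (under i (chord h1)); first by rewrite u1 ?eqxx in ui.
have [c2|c2] := boolP (under i (chord h2)); first by rewrite u2 ?eqxx in ui.
have := tri_cross hT iT cT; move: n1 n2 c1 c2.
rewrite /under !arc_eqE crossE !src_chord !tgt_chord.
rewrite -(val_eqE (src i)) -(val_eqE (tgt i)) /=.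
by clear -h1 h2 li; lia.
Qed.

(* Take [c] shortest in [T] among the arcs strictly covering part of the support
   of [u].  Only the two sides of the triangle under [c] can then contribute
   under [c], with opposite coefficients because the degree at their common
   vertex vanishes; a multiple of [X_vec T c] removes both. *)
Lemma deg0_span T u : ideal_triangulation T -> supported T u -> deg u = 0 ->
  exists n : vec N, u = \sum_(j in internal T) X_vec T j *~ n j.
Proof.
move=> hT.
(* The induction is on the number of arcs of [T] that strictly cover part of the support. *)
pose bad u := [set c in T | [exists i, under i c && (u i != 0)]].
have [m le_m] := ubnP #|bad u|; elim: m u le_m => // m IHm u le_m hu du.
have [N1|N1] := leqP N 1.
  exists 0; rewrite big1 => [|j _]; last by rewrite ffunE mulr0z.
  apply/ffunP => i; exfalso; have := src_lt_tgt i.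
  by have := ltn_ord (tgt i); clear -N1; lia.
have N0 : (0 < N)%N by clear -N1; lia.
have NN : (N.-1 < N)%N by clear -N1; lia.
have h0 : (Ordinal N0 < Ordinal NN)%N by rewrite /=; clear -N1; lia.
have T0 : chord h0 \in T.
  apply: tri_adjacent => //.
  by rewrite adjacentE src_chord tgt_chord /= subn0 eqxx orbT.
have under0 i : i != chord h0 -> under i (chord h0).
  rewrite /under => ->; rewrite src_chord tgt_chord /=.
  by have := ltn_ord (tgt i); clear; lia.
(* Without bad arcs, only the edge from the first to the last marked point can carry weight, and the
   degree at the first one forces it to be 0. *)
have [e|nz] := eqVneq (bad u) set0.
  have u0 i : i != chord h0 -> u i = 0.
    move=> ni; apply: contra_eq e => ui; apply/set0Pn; exists (chord h0).
    by rewrite inE T0; apply/existsP; exists i; rewrite under0.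
  exists 0; rewrite big1 => [|j _]; last by rewrite ffunE mulr0z.
  apply/ffunP => i; rewrite [RHS]ffunE; have [->|/u0 //] := eqVneq i (chord h0).
  have := deg0_sum (Ordinal N0) du; rewrite (bigD1 (chord h0)) //= big1 => [|j nj].
    have -> : (Ordinal NN == Ordinal N0) = false.
      by rewrite -val_eqE /=; clear -N1; lia.
    by rewrite !addr0 mulr1.
  by rewrite u0 ?mul0r.
have [c0 c0b] := set0Pn _ nz.
have [c cb cmin] :=
  @arg_minnP _ c0 (fun c => c \in bad u) (fun c => tgt c - src c)%N c0b.
move: (cb); rewrite inE => /andP[cT /existsP[i0 /andP[i0c ui0]]].
have lc : (src c + 1 < tgt c)%N.
  by move: i0c; rewrite /under arc_eqE; have := src_lt_tgt i0; clear; lia.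
have nbad j i : j \in T -> under j c -> under i j -> u i = 0.
  move=> jT jc ij; apply/eqP; apply: contraTT jc => ui.
  have /cmin : j \in bad u by rewrite inE jT; apply/existsP; exists i; rewrite ij.
  rewrite /under arc_eqE; have := src_lt_tgt j; clear; lia.
have u1 (x : 'I_N) (h1 : (src c < x)%N) (h2 : (x < tgt c)%N) : under (chord h1) c.
  by rewrite /under arc_eqE src_chord tgt_chord; clear -h2; lia.
have u2 (x : 'I_N) (h1 : (src c < x)%N) (h2 : (x < tgt c)%N) : under (chord h2) c.
  by rewrite /under arc_eqE src_chord tgt_chord; clear -h1; lia.
(* A boundary edge covering another arc is the root. The support then lies in the triangle under it,
   and the degrees at its three vertices make the three coefficients vanish, against the choice of
   [i0]. *)
have [adj|nadj] := boolP (adjacent c).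
  have Ec : src c = Ordinal N0 /\ tgt c = Ordinal NN.
    move: adj; rewrite adjacentE; have := ltn_ord (tgt c) => lt adj.
    by split; apply: val_inj => /=; clear -adj lt lc; lia.
  have [x [h1 [h2 [T1 T2]]]] := inner_vertex hT cT lc.
  have [] := under_children hT hu du cT T1 T2.
  - by move=> i; apply: nbad => //; apply: u1.
  - by move=> i; apply: nbad => //; apply: u2.
  move=> E only; exfalso.
  have n12 : chord h2 != chord h1.
    by rewrite arc_eqE !src_chord !tgt_chord; clear -h1 h2; lia.
  have nc1 : chord h1 != c by case/and3P: (u1 x h1 h2).
  have nc2 : chord h2 != c by case/and3P: (u2 x h1 h2).
  have inc i : i != c -> u i != 0 -> i = chord h1 \/ i = chord h2.
    move=> ni; apply: only; move: (Ec) => [es et].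
    rewrite /under ni es et /=; have := ltn_ord (tgt i); clear; lia.
  have vanish i : [&& i != c, i != chord h1 & i != chord h2] -> u i = 0.
    case/and3P => n0 n1 n2; apply/eqP; apply: contraT => /(inc i n0).
    by case=> e; rewrite e eqxx in n1 n2.
  have sumE p : u c * ((src c == p)%:R + (tgt c == p)%:R) +
      u (chord h1) * ((src c == p)%:R + (x == p)%:R) +
      u (chord h2) * ((x == p)%:R + (tgt c == p)%:R) = 0.
    rewrite -[RHS](deg0_sum p du) (bigD1 c) //= (bigD1 (chord h1)) //=.
    rewrite (bigD1 (chord h2)) /=; last by rewrite nc2 n12.
    rewrite big1 ?addr0 ?addrA // => i /andP[/andP[n0 n1] n2].
    by rewrite vanish ?mul0r // n0 n1.
  have := sumE (src c); have := sumE (tgt c).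
  have ord_neq (p r : 'I_N) : (p < r)%N -> ((p == r) = false) * ((r == p) = false).
    by move=> l; rewrite -!(inj_eq val_inj) /= (ltn_eqF l) (gtn_eqF l).
  rewrite !eqxx !(ord_neq _ _ h1) !(ord_neq _ _ h2) !(ord_neq _ _ (src_lt_tgt c)).
  move=> e1 e2.
  have [uh1 uh2] : u (chord h1) = 0 /\ u (chord h2) = 0 by clear -E e1 e2; lia.
  by case: (only i0 i0c ui0) => e; rewrite e ?uh1 ?uh2 eqxx in ui0.
have cI : c \in internal T by rewrite inE cT.
have [x [h1 [h2 [T1 T2 X1 X2 hX]]]] := X_vec_triangle hT cI.
have [] := under_children hT hu du cT T1 T2.
- by move=> i; apply: nbad => //; apply: u1.
- by move=> i; apply: nbad => //; apply: u2.
move=> E only.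
(* The entries of [X_vec T c] on the two sides are 1 and -1, so one multiple cancels both
   coefficients of [u]. *)
pose u' := u - X_vec T c *~ u (chord h1).
have u'E i : u' i = u i - X_vec T c i * u (chord h1).
  by rewrite ffunE; congr (_ + _); rewrite ffunE ffunMzE mulrzz.
have u'1 : u' (chord h1) = 0 by rewrite u'E X1 mul1r subrr.
have u'2 : u' (chord h2) = 0 by rewrite u'E X2 mulN1r opprK addrC.
have u'c i : under i c -> u' i = 0.
  move=> ic; have [->|n1] := eqVneq i (chord h1); first exact: u'1.
  have [->|n2] := eqVneq i (chord h2); first exact: u'2.
  rewrite u'E; have [->|/(only i ic)[e|e]] := eqVneq (u i) 0; last 2 first.
  - by rewrite e eqxx in n1.
  - by rewrite e eqxx in n2.
  have [->|/hX[e|e|[]]] := eqVneq (X_vec T c i) 0; first by rewrite mul0r subr0.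
  - by rewrite e eqxx in n1.
  - by rewrite e eqxx in n2.
  - by rewrite ic.
(* Arcs of [T] that cover an arc newly in the support also cover [i0], hence were already bad. *)
have sub : bad u' \subset bad u.
  apply/subsetP => c'; rewrite !inE => /andP[c'T /existsP[i /andP[ic' u'i]]].
  rewrite c'T; have [ui|ui] := eqVneq (u i) 0; last first.
    by apply/existsP; exists i; rewrite ic'.
  have : X_vec T c i != 0.
    by apply: contraNneq u'i => e; rewrite u'E ui e mul0r subrr.
  case/hX => [e|e|[_ h]]; try by rewrite e ?u'1 ?u'2 eqxx in u'i.
  by apply/existsP; exists i0; rewrite ui0 (h c' i0 c'T ic' i0c).
have [|||n' En'] := IHm u'.
- rewrite -ltnS; apply: leq_trans le_m; rewrite ltnS; apply: proper_card.
  apply/properP; split=> //; exists c => //; rewrite inE cT /=.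
  by apply/existsPn => i; apply/negP => /andP[/u'c->]; rewrite eqxx.
- by apply/supportedD/supportedN/supportedMz/X_vec_supported.
- by rewrite degD degN degMz deg_X_vec // du mul0rz subr0.
exists (n' + basis_vec c *~ u (chord h1)).
transitivity (u' + X_vec T c *~ u (chord h1)); first by rewrite subrK.
rewrite {1}En'; rewrite [RHS](eq_bigr (fun j => X_vec T j *~ n' j +
  (if j == c then X_vec T c *~ u (chord h1) else 0))) => [|j _].
  rewrite big_split /= -big_mkcondr /=; congr (_ + _); rewrite (big_pred1 c) // => j /=.
  by case: (eqVneq j c) => [->|ne]; rewrite ?eqxx ?cI ?(negPf ne) ?andbF.
rewrite ffunE ffunMzE basis_vecE mulrzDr; congr (_ + _).
by case: (eqVneq j c) => [->|_]; rewrite mulrzz ?mul1r ?mul0r ?mulr0z.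
Qed.

End Span.

(** * Flips in a quadrilateral *)

Section Flip.
Variable N : nat.
Implicit Types (i j k : ideal_arc N) (T : {set ideal_arc N}).

(** For maximality: an arc crossing nothing in the new set either crosses [k], and is then [k'], or
    lies in [T] by maximality of [T], and differs from [k] because [k] crosses [k']. *)
Lemma tri_flip T k k' : ideal_triangulation T -> k \in T -> cross k k' ->
  (forall j, j \in T -> j != k -> ~~ cross k' j) ->
  (forall i, cross i k -> (forall j, j \in T -> j != k -> ~~ cross i j) -> i = k') ->
  flip T k k' (k' |: (T :\ k)).
Proof.
move=> hT kT ckk' hk' hk; have [/noncrossingP nc _] := triP _ hT.
split=> //.
- by rewrite inE kT; apply: contraL ckk' => /adjacent_cross->.
- by apply: contraL ckk' => k'T; apply: nc.
apply/triP; split.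
  apply/noncrossingP => i j /setU1P[->|/setD1P[ni iT]] /setU1P[->|/setD1P[nj jT]].
  - by rewrite cross_irr.
  - exact: hk'.
  - by rewrite crossC hk'.
  - exact: nc.
move=> i hi.
have hi' j : j \in T -> j != k -> ~~ cross i j.
  by move=> jT nj; apply: hi; rewrite setU1r // in_setD1 nj.
have [cik|ncik] := boolP (cross i k); first by rewrite (hk i) ?setU11.
have iT : i \in T.
  apply: tri_max => // j jT; have [->//|nj] := eqVneq j k; exact: hi'.
rewrite setU1r // in_setD1 iT andbT; apply: contraTneq (hi k' (setU11 _ _)) => ->.
by rewrite ckk'.
Qed.

Section Quad.
Variables (w x y z : 'I_N).
Variables (wx : (w < x)%N) (xy : (x < y)%N) (yz : (y < z)%N)
  (wz : (w < z)%N) (wy : (w < y)%N) (xz : (x < z)%N).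

Lemma cross_diagonals : cross (chord wy) (chord xz).
Proof. by rewrite crossE !src_chord !tgt_chord wx xy yz. Qed.

Lemma quad_crossing_arc i : ~~ cross i (chord wx) -> ~~ cross i (chord xy) ->
  ~~ cross i (chord yz) -> ~~ cross i (chord wz) ->
  (cross i (chord wy) -> i = chord xz) /\ (cross i (chord xz) -> i = chord wy).
Proof.
have := src_lt_tgt i; rewrite !crossE !src_chord !tgt_chord => l c1 c2 c3 c4.
split=> c5; apply/eqP; rewrite arc_eqE src_chord tgt_chord.
  by clear -l c1 c2 c3 c4 c5 wx xy yz; lia.
by clear -l c1 c2 c3 c4 c5 wx xy yz; lia.
Qed.

Lemma quad_noncrossing_arc i : ~~ cross i (chord wx) -> ~~ cross i (chord xy) ->
  ~~ cross i (chord yz) -> ~~ cross i (chord wz) ->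
  (~~ cross i (chord wy) -> i != chord wy -> ~~ cross i (chord xz)) /\
  (~~ cross i (chord xz) -> i != chord xz -> ~~ cross i (chord wy)).
Proof.
move=> c1 c2 c3 c4; have [h1 h2] := quad_crossing_arc c1 c2 c3 c4.
split=> n1 n2; apply/negP => c; first by rewrite (h2 c) eqxx in n2.
by rewrite (h1 c) eqxx in n2.
Qed.

Lemma quad_flip T : ideal_triangulation T ->
  chord wx \in T -> chord xy \in T -> chord yz \in T -> chord wz \in T ->
  (chord wy \in T -> flip T (chord wy) (chord xz) (chord xz |: (T :\ chord wy))) /\
  (chord xz \in T -> flip T (chord xz) (chord wy) (chord wy |: (T :\ chord xz))).
Proof.
move=> hT h1 h2 h3 h4; have cd := cross_diagonals.
have n1 : chord wx != chord wy by rewrite arc_eqE !src_chord !tgt_chord; clear -xy; lia.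
have n2 : chord xy != chord wy by rewrite arc_eqE !src_chord !tgt_chord; clear -wx; lia.
have n3 : chord yz != chord wy by rewrite arc_eqE !src_chord !tgt_chord; clear -wy; lia.
have n4 : chord wz != chord wy by rewrite arc_eqE !src_chord !tgt_chord; clear -yz; lia.
have m1 : chord wx != chord xz by rewrite arc_eqE !src_chord !tgt_chord; clear -wx; lia.
have m2 : chord xy != chord xz by rewrite arc_eqE !src_chord !tgt_chord; clear -yz; lia.
have m3 : chord yz != chord xz by rewrite arc_eqE !src_chord !tgt_chord; clear -xy; lia.
have m4 : chord wz != chord xz by rewrite arc_eqE !src_chord !tgt_chord; clear -wx; lia.
split=> h5; apply: tri_flip => //.
- move=> j jT nj; rewrite crossC.
  have nc k : k \in T -> ~~ cross j k by move=> kT; apply: tri_cross hT jT kT.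
  have [h _] := quad_noncrossing_arc (nc _ h1) (nc _ h2) (nc _ h3) (nc _ h4).
  by apply: h; rewrite ?nc.
- move=> i ci nc.
  have [h _] := quad_crossing_arc (nc _ h1 n1) (nc _ h2 n2) (nc _ h3 n3) (nc _ h4 n4).
  exact: h.
- by rewrite crossC.
- move=> j jT nj; rewrite crossC.
  have nc k : k \in T -> ~~ cross j k by move=> kT; apply: tri_cross hT jT kT.
  have [_ h] := quad_noncrossing_arc (nc _ h1) (nc _ h2) (nc _ h3) (nc _ h4).
  by apply: h; rewrite ?nc.
- move=> i ci nc.
  have [_ h] := quad_crossing_arc (nc _ h1 m1) (nc _ h2 m2) (nc _ h3 m3) (nc _ h4 m4).
  exact: h.
Qed.

(** Provides a triangulation in which the flip of a given quadrilateral takes place, since the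
    triangulation used for expansions need not contain its sides. *)
Lemma quad_tri_ex k : k = chord wy \/ k = chord xz ->
  exists T, [/\ ideal_triangulation T, k \in T, chord wx \in T, chord xy \in T
    & chord yz \in T /\ chord wz \in T].
Proof.
move=> hk; pose Q := [set chord wx; chord xy; chord yz; chord wz].
pose S := k |: Q.
have nS : noncrossing S.
  have sides i j : i \in Q -> [\/ j \in Q, j = chord wy | j = chord xz] ->
      ~~ cross i j.
    rewrite !inE -!orbA => hi hj.
    have {hj} : [\/ j = chord wx, j = chord xy, j = chord yz
                  | [\/ j = chord wz, j = chord wy | j = chord xz]].
      case: hj => [|->|->]; [|by apply/Or44/Or32|by apply/Or44/Or33].
      by case/or4P=> /eqP->;
        [apply: Or41|apply: Or42|apply: Or43|apply: Or44; apply: Or31].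
    by case/or4P: hi => /eqP-> [->|->|->|[->|->|->]];
      rewrite crossE !src_chord !tgt_chord; clear -wx xy yz; lia.
  apply/noncrossingP => i j /setU1P[->|iS] /setU1P[->|jS].
  - by rewrite cross_irr.
  - by rewrite crossC; apply: sides => //; case: hk => ->; [apply: Or32|apply: Or33].
  - by apply: sides => //; case: hk => ->; [apply: Or32|apply: Or33].
  - by apply: sides => //; apply: Or31.
have [T hT /subsetP sST] := tri_ex nS.
by exists T; split=> //; try split; apply: sST; rewrite !inE eqxx ?orbT.
Qed.

End Quad.
End Flip.

(** * Toric frames *)

(* The sequence may list a key several times: its coefficients add up. *)
Lemma fsfun_of_seq (K : choiceType) (s : seq (int * K)) :
  exists f : {fsfun K -> int with 0},
    {subset finsupp f <= [seq t.2 | t <- s]} /\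
    forall (R : pzRingType) (g : K -> R),
      \sum_(k <- finsupp f) (f k)%:~R * g k = \sum_(t <- s) t.1%:~R * g t.2.
Proof.
pose ks := [seq t.2 | t <- s].
pose f : {fsfun K -> int with 0} :=
  [fsfun k in seq_fset tt ks => \sum_(t <- s | t.2 == k) t.1].
have fE k : k \in ks -> f k = \sum_(t <- s | t.2 == k) t.1.
  by move=> kD; rewrite fsfunE seq_fsetE kD.
have sub : {subset finsupp f <= ks}.
  move=> k; rewrite mem_finsupp fsfunE seq_fsetE.
  by case: (k \in ks); rewrite ?eqxx.
exists f; split=> // R g.
have fperm : perm_eq (finsupp f) [seq k <- undup ks | f k != 0].
  apply: uniq_perm; rewrite ?fset_uniq ?filter_uniq ?undup_uniq // => k.
  rewrite mem_filter mem_undup -mem_finsupp.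
  by apply/idP/andP => [h|[]//]; split=> //; apply: sub.
rewrite (perm_big _ fperm) big_filter.
transitivity (\sum_(k <- undup ks) \sum_(t <- s | t.2 == k) t.1%:~R * g k).
  rewrite big_mkcond big_seq [RHS]big_seq; apply: eq_bigr => k.
  rewrite mem_undup => kD; rewrite -mulr_suml -rmorph_sum -fE //.
  by case: eqVneq => [->|]; rewrite ?mul0r.
rewrite (exchange_big_dep predT) //= [LHS]big_seq [RHS]big_seq.
apply: eq_bigr => t ts; rewrite -big_filter.
rewrite (eq_filter (a2 := pred1 t.2)); last by move=> k; rewrite /= eq_sym.
by rewrite filter_pred1_uniq ?undup_uniq ?big_seq1 // mem_undup map_f.
Qed.

Section Quantum.
Variables (N : nat) (F : unitRingType) (omega : F).
Variable M : {set ideal_arc N} -> vec N -> F.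
Hypotheses (hF : GRing.field_axiom F) (hM : toric_frames omega M).
Implicit Types (i j k : ideal_arc N) (T : {set ideal_arc N}) (u v : vec N).

(** Linear independence makes every relation formal: once equal keys are collected all coefficients
    vanish, so any values [g] may replace the basis elements. Setting [omega] to 1 is one such
    replacement. *)
Lemma torus_free T (s : seq (int * (vec N * int))) : ideal_triangulation T ->
  (forall t, t \in s -> supported T t.2.1) ->
  \sum_(t <- s) t.1%:~R * (omega ^ t.2.2 * M T t.2.1) = 0 ->
  forall (R : pzRingType) (g : vec N * int -> R), \sum_(t <- s) t.1%:~R * g t.2 = 0.
Proof.
move=> hT hs s0 R g; have [f [sub fE]] := fsfun_of_seq s.
suff f0 : finsupp f = fset0 by rewrite -fE f0 big_seq_fset0.
apply: (tf_free hM hT) => [m /sub/mapP[t ts ->]|]; first exact: hs.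
rewrite -[RHS]s0 -[RHS](fE F (fun m => omega ^ m.2 * M T m.1)).
by apply: eq_bigr => m _; rewrite mulrA.
Qed.

(** Otherwise [omega] would be 0, and the single term [omega * M T 0] would be a nontrivial
    relation. *)
Lemma omega_unit : omega \is a GRing.unit.
Proof.
apply: hF; apply/eqP => om0.
have nc0 : noncrossing (set0 : {set ideal_arc N}).
  by apply/noncrossingP => i j; rewrite inE.
have [T hT _] := tri_ex nc0.
have : \sum_(t <- [:: (1 : int, (GRing.zero : vec N, 1 : int))])
    t.1%:~R * (1 : int) = 0.
  apply: (torus_free hT _ _ (fun=> 1)) => [t|].
    by rewrite inE => /eqP->; apply: supported0.
  by rewrite big_seq1 om0 expr1z mul0r mulr0.
by rewrite big_seq1.
Qed.

Lemma omegaC n x : omega ^ n * x = x * omega ^ n.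
Proof. by apply/esym/commrXz; apply/esym/(tf_central hM). Qed.

Lemma omegaD m n : omega ^ (m + n) = omega ^ m * omega ^ n.
Proof. exact/exprzDr/omega_unit. Qed.

Lemma M_add T u v : ideal_triangulation T -> supported T u -> supported T v ->
  M T (u + v) = omega ^ Lambda T u v * (M T u * M T v).
Proof.
move=> hT hu hv; rewrite (tf_mul hM) // mulrA -omegaD addrN expr0z mul1r //.
Qed.

Lemma M_unit T u : ideal_triangulation T -> supported T u -> M T u \is a GRing.unit.
Proof. by move=> hT hu; apply/hF/(tf_neq0 hM). Qed.

(** The form is skew, so it vanishes on pairs of multiples of [u] and no power of [omega]
    appears. *)
Lemma M_Mz T u n : ideal_triangulation T -> supported T u -> M T (u *~ n) = M T u ^ n.
Proof.
move=> hT hu; have LL m m' : Lambda T (u *~ m) (u *~ m') = 0.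
  rewrite LambdaE; try exact: supportedMz.
  transitivity (m * m' * Lambda T u u); last by rewrite Lambda_self ?mulr0.
  rewrite LambdaE // mulr_sumr; apply: eq_bigr => i _; rewrite mulr_sumr.
  by apply: eq_bigr => j _; rewrite !ffunMzE !mulrzz; ring.
have Mn (m : nat) : M T (u *~ m) = M T u ^+ m.
  elim: m => [|m IH]; first by rewrite mulr0z (tf_zero hM) ?expr0.
  rewrite -addn1 PoszD mulrzDr M_add //; try exact: supportedMz.
  by rewrite LL expr0z mul1r IH mulr1z addn1 exprSr.
case: n => n; first exact: Mn.
apply: (mulrI (M_unit hT (supportedMz (n := Posz n.+1) hu))).
rewrite (tf_mul hM) //; try exact: supportedMz.
rewrite LL oppr0 expr0z mul1r -mulrzDr NegzE subrr mulr0z (tf_zero hM) //.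
by rewrite Mn -exprnN divrr // unitrX // M_unit.
Qed.

Lemma M_opp T u : ideal_triangulation T -> supported T u -> M T (- u) = (M T u)^-1.
Proof. by move=> hT hu; rewrite -mulrN1z M_Mz // exprN1. Qed.

(** As the value at [k'] is the same in every triangulation containing it, [T'] can be replaced by
    the flip of [T] at [k]. Exchanging the diagonals changes the sign of the exchange row, which
    only swaps the two terms. *)
Lemma M_flip T T' (w x y z : 'I_N) (wx : (w < x)%N) (xy : (x < y)%N)
    (yz : (y < z)%N) (wz : (w < z)%N) (wy : (w < y)%N) (xz : (x < z)%N) k k' :
  (k = chord wy /\ k' = chord xz) \/ (k = chord xz /\ k' = chord wy) ->
  ideal_triangulation T -> ideal_triangulation T' ->
  chord wx \in T -> chord xy \in T -> chord yz \in T -> chord wz \in T ->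
  k \in T -> k' \in T' ->
  M T' (basis_vec k') =
    M T (basis_vec (chord wx) + basis_vec (chord yz) - basis_vec k) +
    M T (basis_vec (chord xy) + basis_vec (chord wz) - basis_vec k).
Proof.
move=> hk hT hT' h1 h2 h3 h4 kT k'T'.
have fl : flip T k k' (k' |: (T :\ k)).
  have [f1 f2] := quad_flip wy xz hT h1 h2 h3 h4.
  by case: hk kT => [[-> ->]|[-> ->]]; [apply: f1|apply: f2].
have [_ _ _ hT''] := fl.
rewrite (tf_arc hM hT' hT'' k'T' (setU11 _ _)) (tf_flip hM hT fl).
have S1 : supported T (basis_vec (chord wx) + basis_vec (chord yz)).
  by apply: supportedD; apply: supported_basis.
have S2 : supported T (basis_vec (chord xy) + basis_vec (chord wz)).
  by apply: supportedD; apply: supported_basis.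
have fE (c : int) v : supported T v -> (forall i, pos_part (c * eps T k i) = v i) ->
    flip_vec T k c = v - basis_vec k.
  move=> hv hc; rewrite /flip_vec addrC; congr (_ - _).
  rewrite [RHS](vec_sum_basis hv); apply: eq_bigr => i _; by rewrite hc.
case: hk => -[Ek Ek']; rewrite {}Ek in fl kT fE *.
  have e i := eps_wy xz hT h1 h2 h3 h4 i kT.
  rewrite (fE 1 _ S1) => [|i]; last by rewrite mul1r e pos_part_quad_sgn [RHS]ffunE.
  by rewrite (fE (-1) _ S2) => [//|i]; rewrite mulN1r e pos_part_opp_quad_sgn [RHS]ffunE.
have e i := eps_xz wy hT h1 h2 h3 h4 i kT.
rewrite (fE 1 _ S2) => [|i]; last by rewrite mul1r e pos_part_opp_quad_sgn [RHS]ffunE.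
rewrite (fE (-1) _ S1) => [|i]; first by rewrite addrC.
by rewrite mulN1r e opprK pos_part_quad_sgn [RHS]ffunE.
Qed.

End Quantum.

(** * Lifts of classical Laurent polynomials *)

Section Lifts.
Variables (N : nat) (F : unitRingType) (omega : F).
Variable M : {set ideal_arc N} -> vec N -> F.
Hypotheses (hF : GRing.field_axiom F) (hM : toric_frames omega M).
Variable C : fieldType.
Implicit Types (i j k : ideal_arc N) (T : {set ideal_arc N}) (u v : vec N).
Implicit Types (d : {ffun 'I_N -> int}) (x : F) (y : C).

Definition ptolemy (A : ideal_arc N -> C) : Prop :=
  forall (p q r s : 'I_N) (pq : (p < q)%N) (qr : (q < r)%N) (rs : (r < s)%N)
    (ps : (p < s)%N) (pr : (p < r)%N) (qs : (q < s)%N),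
  A (chord pr) * A (chord qs) =
  A (chord pq) * A (chord rs) + A (chord qr) * A (chord ps).

Variables (A : ideal_arc N -> C) (T : {set ideal_arc N}).
Hypotheses (hT : ideal_triangulation T) (hA : {in T, forall i, A i != 0}).

Definition monomial u : C := \prod_(i in T) A i ^ u i.

Lemma monomial0 : monomial 0 = 1.
Proof. by rewrite /monomial big1 // => i _; rewrite ffunE. Qed.

Lemma monomialD u v : monomial (u + v) = monomial u * monomial v.
Proof.
rewrite /monomial -big_split; apply: eq_bigr => i iT /=.
by rewrite ffunE expfzDr ?hA.
Qed.

Lemma monomialN u : monomial (- u) = (monomial u)^-1.
Proof.
rewrite /monomial -prodfV; apply: eq_bigr => i iT /=.
by rewrite ffunE invr_expz.
Qed.

Lemma monomial_basis i : i \in T -> monomial (basis_vec i) = A i.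
Proof.
move=> iT; rewrite /monomial (bigD1 i) //= basis_vecE eqxx expr1z big1 ?mulr1 //.
by move=> j /andP[_ nj]; rewrite basis_vecE (negPf nj) expr0z.
Qed.

Lemma monomialMz u n : monomial (u *~ n) = monomial u ^ n.
Proof.
rewrite /monomial; elim/big_rec2: _ => [|i a b iT ->]; first by rewrite exp1rz.
by rewrite ffunMzE mulrzz expfzMl exprz_exp.
Qed.

(* [x] is an integral combination of the [omega ^ (4 n) M_T(u)] with [u] of
   degree [d], and [y] is the value of this combination at [omega = 1]. *)
Definition lifts d x y : Prop :=
  exists s : seq (int * (vec N * int)),
  [/\ forall t, t \in s -> supported T t.2.1 /\ deg t.2.1 = d,
      x = \sum_(t <- s) t.1%:~R * (omega ^ (4 * t.2.2) * M T t.2.1)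
    & y = \sum_(t <- s) t.1%:~R * monomial t.2.1].

Lemma lifts0 d : lifts d 0 0.
Proof. by exists [::]; split=> //; rewrite big_nil. Qed.

Lemma liftsD d x y x' y' : lifts d x y -> lifts d x' y' -> lifts d (x + x') (y + y').
Proof.
case=> s [s1 -> ->] [s' [s1' -> ->]]; exists (s ++ s'); split; rewrite ?big_cat //.
by move=> t; rewrite mem_cat => /orP[/s1|/s1'].
Qed.

Lemma lifts_int d x y (c : int) : lifts d x y -> lifts d (c%:~R * x) (c%:~R * y).
Proof.
case=> s [s1 -> ->]; exists [seq (c * t.1, t.2) | t <- s]; split.
- by move=> _ /mapP[t ts ->]; exact: (s1 t ts).
- by rewrite big_map mulr_sumr; apply: eq_bigr => t _; rewrite intrM mulrA.
- by rewrite big_map mulr_sumr; apply: eq_bigr => t _; rewrite intrM mulrA.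
Qed.

Lemma lifts_omega d x y (n : int) :
  (4 %| n)%Z -> lifts d x y -> lifts d (omega ^ n * x) y.
Proof.
case/dvdzP=> m ->; case=> s [s1 -> ->].
exists [seq (t.1, (t.2.1, m + t.2.2)) | t <- s]; split.
- by move=> _ /mapP[t ts ->]; exact: (s1 t ts).
- rewrite big_map mulr_sumr; apply: eq_bigr => t _ /=.
  have -> : 4 * (m + t.2.2) = m * 4 + 4 * t.2.2 by ring.
  by rewrite (omegaD hF hM) !mulrA (omegaC hM).
- by rewrite big_map.
Qed.

Lemma lifts_sum d (I : eqType) (r : seq I) (f : I -> F) (g : I -> C) :
  (forall a, a \in r -> lifts d (f a) (g a)) ->
  lifts d (\sum_(a <- r) f a) (\sum_(a <- r) g a).
Proof.
move=> h; rewrite big_seq [X in lifts _ _ X]big_seq.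
apply: (big_ind2 (lifts d)) => //; first exact: lifts0.
by move=> *; apply: liftsD.
Qed.

Lemma lifts_M u : supported T u -> lifts (deg u) (M T u) (monomial u).
Proof.
move=> hu; exists [:: (1, (u, 0))]; rewrite !big_seq1 /= mulr0 expr0z !mul1r.
by split=> // t; rewrite inE => /eqP->.
Qed.

(** Multiplying two monomials produces the exponent [- Lambda], which varies with the pair. The
    factor depending on degrees alone corrects all pairs at once, by [Lambda_mod4]. *)
Lemma liftsM d d' x y x' y' : lifts d x y -> lifts d' x' y' ->
  lifts (d + d') (omega ^ degform d d' * (x * x')) (y * y').
Proof.
case=> s [s1 -> ->] [s' [s1' -> ->]].
rewrite !mulr_suml mulr_sumr; apply: lifts_sum => t ts.
rewrite !mulr_sumr; apply: lifts_sum => t' ts'.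
have [u1 u2] := s1 t ts; have [u1' u2'] := s1' t' ts'.
have -> : omega ^ degform d d' * (t.1%:~R * (omega ^ (4 * t.2.2) * M T t.2.1) *
    (t'.1%:~R * (omega ^ (4 * t'.2.2) * M T t'.2.1))) =
    t.1%:~R * (t'.1%:~R * (omega ^ (4 * t.2.2) * (omega ^ (4 * t'.2.2) *
    (omega ^ (degform d d' - Lambda T t.2.1 t'.2.1) * M T (t.2.1 + t'.2.1))))).
  rewrite (omegaD hF hM) -[omega ^ _ * omega ^ _ * _]mulrA -(tf_mul hM) //.
  have intCA (z : F) (c : int) z' : z * (c%:~R * z') = c%:~R * (z * z').
    by rewrite !mulrA (commr_int z c).
  have omegaCA z (n : int) z' : z * (omega ^ n * z') = omega ^ n * (z * z').
    by rewrite !mulrA (omegaC hM).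
  rewrite -!mulrA (intCA (M T _)) (omegaCA (M T _)) (intCA (omega ^ (4 * _))).
  rewrite (intCA (omega ^ degform _ _)) (intCA (omega ^ degform _ _)).
  by rewrite !(omegaCA (omega ^ degform _ _)).
have -> : t.1%:~R * monomial t.2.1 * (t'.1%:~R * monomial t'.2.1) =
   t.1%:~R * (t'.1%:~R * monomial (t.2.1 + t'.2.1)).
  by rewrite monomialD; ring.
do 2!apply: lifts_int; do 2!(apply: lifts_omega; first exact: dvdz_mulr).
apply: lifts_omega; first by rewrite -u2 -u2' Lambda_mod4.
by rewrite -u2 -u2' -degD; apply/lifts_M/supportedD.
Qed.

Section Triangulation.
Variable (T' : {set ideal_arc N}).
Hypothesis (hT' : ideal_triangulation T').

Definition lifts_vec u y := supported T' u /\ lifts (deg u) (M T' u) y.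

Lemma lifts_vec0 : lifts_vec 0 1.
Proof.
split; first exact: supported0.
rewrite (tf_zero hM) // -(tf_zero hM hT) -monomial0; apply: lifts_M.
exact: supported0.
Qed.

Lemma lifts_vecD u v y y' :
  lifts_vec u y -> lifts_vec v y' -> lifts_vec (u + v) (y * y').
Proof.
case=> [hu ly] [hv ly']; split; first exact: supportedD.
rewrite (M_add hF hM) // degD.
(* The congruence modulo 4 is used a second time, now in [T']: it trades the exponent [degform] of
   [liftsM] for the exponent [Lambda T' u v] of [M_add]. *)
have := lifts_omega _ (liftsM ly ly').
move/(_ (- (degform (deg u) (deg v) - Lambda T' u v))).
rewrite rpredN Lambda_mod4 // => /(_ isT); rewrite mulrA -(omegaD hF hM).
by rewrite opprB subrK.
Qed.

(** Arcs of [T] are invertible monomials of the torus of [T], which allows negative exponents on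
    them. *)
Lemma lifts_vec_basisN i : i \in T -> i \in T' -> lifts_vec (- basis_vec i) (A i)^-1.
Proof.
move=> iT iT'; split; first by apply/supportedN/supported_basis.
rewrite (M_opp hF hM) ?supported_basis //; last exact: supported_basis.
rewrite (tf_arc hM hT' hT) // -(M_opp hF hM) //; last exact: supported_basis.
rewrite -monomial_basis // -monomialN; apply/lifts_M/supportedN.
exact: supported_basis.
Qed.

End Triangulation.

Hypothesis hP : ptolemy A.

(** By [arc_ind], the new arc [k'] is one diagonal of a quadrilateral whose other diagonal [k] is in
    [T] and whose sides are already expanded. The Ptolemy relation divides by [k] only, and both of
    its terms have the degree of [k']. *)
Lemma lifts_arc T' i : ideal_triangulation T' -> i \in T' ->
  lifts_vec T' (basis_vec i) (A i).
Proof.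
move=> hT' iT'; split; first exact: supported_basis.
move: i T' hT' iT'; apply: (arc_ind hT) => [i iT T' hT' iT'|].
  by rewrite (tf_arc hM hT' hT) // -monomial_basis //; apply/lifts_M/supported_basis.
move=> p q r s pq qr rs ps pr qs l1 l2 l3 l4.
have main k k' : (k = chord pr /\ k' = chord qs) \/ (k = chord qs /\ k' = chord pr) ->
    A k * A k' = A (chord pq) * A (chord rs) + A (chord qr) * A (chord ps) ->
    deg (basis_vec k) + deg (basis_vec k') =
      deg (basis_vec (chord pq)) + deg (basis_vec (chord rs)) ->
    deg (basis_vec k) + deg (basis_vec k') =
      deg (basis_vec (chord qr)) + deg (basis_vec (chord ps)) ->
    k \in T -> forall T', ideal_triangulation T' -> k' \in T' ->
    lifts (deg (basis_vec k')) (M T' (basis_vec k')) (A k').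
  move=> hk eA d1 d2 kT T' hT' k'T'.
  (* The flip takes place in the auxiliary [T2], while all expansions remain in [T]. *)
  have [|T2 [hT2 kT2 h1 h2 [h3 h4]]] := @quad_tri_ex _ _ _ _ _ pq qr rs ps pr qs k.
    by case: hk => -[-> _]; [left|right].
  rewrite (M_flip hM hk hT2 hT' h1 h2 h3 h4 kT2 k'T').
  have lv j : j \in T2 -> (forall T', ideal_triangulation T' -> j \in T' ->
      lifts (deg (basis_vec j)) (M T' (basis_vec j)) (A j)) ->
      lifts_vec T2 (basis_vec j) (A j).
    by move=> jT2 h; split; [apply: supported_basis|apply: h].
  have lN := lifts_vec_basisN hT2 kT kT2.
  have [_ L1] := lifts_vecD hT2 (lifts_vecD hT2 (lv _ h1 l1) (lv _ h3 l3)) lN.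
  have [_ L2] := lifts_vecD hT2 (lifts_vecD hT2 (lv _ h2 l2) (lv _ h4 l4)) lN.
  have -> : A k' = A (chord pq) * A (chord rs) / A k + A (chord qr) * A (chord ps) / A k.
    by rewrite -mulrDl -eA mulrAC mulfV ?mul1r ?hA.
  apply: liftsD.
    by move: L1; rewrite degD degN degD -d1 addrAC addrN add0r.
  by move: L2; rewrite degD degN degD -d2 addrAC addrN add0r.
have degE := @deg_basis N.
have Edeg : deg (basis_vec (chord pr)) + deg (basis_vec (chord qs)) =
      deg (basis_vec (chord pq)) + deg (basis_vec (chord rs)).
  apply/ffunP => a; move: (degE (chord pr) a) (degE (chord qs) a).
  move: (degE (chord pq) a) (degE (chord rs) a); rewrite !src_chord !tgt_chord.
  move: (deg _) (deg _) (deg _) (deg _) => d1 d2 d3 d4 e1 e2 e3 e4.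
  by rewrite !ffunE e1 e2 e3 e4; ring.
have Edeg' : deg (basis_vec (chord pr)) + deg (basis_vec (chord qs)) =
      deg (basis_vec (chord qr)) + deg (basis_vec (chord ps)).
  apply/ffunP => a; move: (degE (chord pr) a) (degE (chord qs) a).
  move: (degE (chord qr) a) (degE (chord ps) a); rewrite !src_chord !tgt_chord.
  move: (deg _) (deg _) (deg _) (deg _) => d1 d2 d3 d4 e1 e2 e3 e4.
  by rewrite !ffunE e1 e2 e3 e4; ring.
have eA := hP pq qr rs ps pr qs.
split; first exact: (main _ _ (or_introl (conj erefl erefl)) eA Edeg Edeg').
exact: (main _ _ (or_intror (conj erefl erefl)) (etrans (mulrC _ _) eA)
  (etrans (addrC _ _) Edeg) (etrans (addrC _ _) Edeg')).
Qed.

End Lifts.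

(** * Laurent expansions in the X-coordinates and their classical values *)

Section Laurent.
Variables (N : nat) (F : unitRingType) (omega : F).
Variable M : {set ideal_arc N} -> vec N -> F.
Hypotheses (hF : GRing.field_axiom F) (hM : toric_frames omega M).
Implicit Types (i j k : ideal_arc N) (T : {set ideal_arc N}) (u v : vec N).

(** Both frames agree on the arcs in the support and multiply by the same form. Hence the image of a
    lamination does not depend on the adapted triangulation. *)
Lemma M_indep_triangulation T T' u : ideal_triangulation T -> ideal_triangulation T' ->
  supported T u -> supported T' u -> M T u = M T' u.
Proof.
move=> hT hT' hu hu'.
pose P v := [/\ supported T v, supported T' v & M T v = M T' v].
suff [_ _ //] : P u.
rewrite (vec_sum_basis hu).
have PD v v' : P v -> P v' -> P (v + v').
  case=> s1 s1' e [s2 s2' e']; split; try exact: supportedD.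
  by rewrite !(M_add hF hM) // e e' !LambdaE.
apply: big_ind => //.
  by split; try exact: supported0; rewrite !(tf_zero hM).
move=> i iT; have [->|ui] := eqVneq (u i) 0.
  by rewrite mulr0z; split; try exact: supported0; rewrite !(tf_zero hM).
have iT' := hu' i ui.
split; try by apply/supportedMz/supported_basis.
by rewrite !(M_Mz hF hM) ?(tf_arc hM hT hT') //; apply: supported_basis.
Qed.

Section Fixed.
Variables (T : {set ideal_arc N}) (hT : ideal_triangulation T).

Definition X_sum (n : vec N) : vec N := \sum_(j in internal T) X_vec T j *~ n j.

Lemma X_sum_supported n : supported T (X_sum n).
Proof. by apply: supported_sum => j _; apply/supportedMz/X_vec_supported. Qed.

Lemma deg_X_sum n : deg (X_sum n) = 0.
Proof.
rewrite /X_sum; apply: (big_ind (fun v => deg v = 0)); first exact: deg0.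
  by move=> u v; rewrite degD => -> ->; rewrite addr0.
by move=> j jT; rewrite degMz deg_X_vec ?mul0rz.
Qed.

(** X-vectors have degree 0, so [Lambda] takes multiples of 4 on them and merging the factors costs
    only powers of [omega ^ 4]. *)
Lemma prod_qX (n : vec N) : exists k : int,
  \prod_(j in internal T) qX M T j ^ n j = omega ^ (4 * k) * M T (X_sum n).
Proof.
suff : [/\ supported T (X_sum n), deg (X_sum n) = 0 & exists k : int,
    \prod_(j in internal T) qX M T j ^ n j = omega ^ (4 * k) * M T (X_sum n)].
  by case.
rewrite /X_sum; elim/big_rec2: _ => [|j a u jT [hu du [k ->]]].
  split; [exact: supported0|exact: deg0|exists 0].
  by rewrite mulr0 expr0z mul1r (tf_zero hM).
have hX : supported T (X_vec T j *~ n j) by apply/supportedMz/X_vec_supported.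
have dX : deg (X_vec T j *~ n j) = 0 by rewrite degMz deg_X_vec ?mul0rz.
split; [exact: supportedD|by rewrite degD du dX addr0|].
have := Lambda_mod4 hT hX hu; rewrite dX degform0l sub0r => /dvdzP[m Em].
exists (m + k); rewrite -(M_Mz hF hM) //; last exact: X_vec_supported.
rewrite mulrA -(omegaC hM) -mulrA (tf_mul hM) // Em mulrA -(omegaD hF hM).
congr (omega ^ _ * _); ring.
Qed.

Lemma qX_eval_seq (s : seq (int * (vec N * int))) :
  exists L, qX_eval omega M T L = \sum_(t <- s) t.1%:~R *
    (omega ^ (4 * t.2.2) * \prod_(j in internal T) qX M T j ^ t.2.1 j).
Proof.
have [L [_ LE]] := fsfun_of_seq s; exists L.
rewrite -(LE F (fun m => omega ^ (4 * m.2) * \prod_(j in internal T) qX M T j ^ m.1 j)).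
by apply: eq_bigr => m _; rewrite mulrA /qparam -exprz_exp.
Qed.

Lemma qX_eval_in_Xq L : in_Xq omega M (qX_eval omega M T L).
Proof.
move=> K [K1 KB KV] Kq KX.
have K0 : 0 \in K by rewrite -(subrr 1) KB.
have KN x : x \in K -> - x \in K by move=> hx; rewrite -sub0r KB.
have KD x y : x \in K -> y \in K -> x + y \in K.
  by move=> hx hy; rewrite -[y]opprK KB // KN.
have Ki x : x \in K -> x^-1 \in K by move=> hx; rewrite -div1r KV.
have KM x y : x \in K -> y \in K -> x * y \in K.
  by move=> hx hy; rewrite -[y]invrK KV // Ki.
have Kn x (n : nat) : x \in K -> x ^+ n \in K.
  by move=> hx; elim: n => [//|n IH]; rewrite exprS KM.
have Kz x (n : int) : x \in K -> x ^ n \in K.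
  by case: n => n hx; rewrite ?NegzE ?exprnN; [exact: Kn|apply/Ki/Kn].
have Kint (c : int) : c%:~R \in K.
  have Knat (n : nat) : n%:R \in K by elim: n => [//|n IH]; rewrite mulrS KD.
  by case: c => n; [exact: Knat|rewrite NegzE mulrNz KN //; exact: Knat].
rewrite /qX_eval; apply: (big_ind (fun x => x \in K)) => // m _.
apply: (KM); first by apply: KM => //; apply: Kz.
by apply: (big_ind (fun x => x \in K)) => // j jT; apply: Kz; apply: KX.
Qed.

Variables (C : fieldType) (A : ideal_arc N -> C).
Hypothesis hA : {in T, forall i, A i != 0}.
Local Notation lifts := (lifts omega M A T).

Lemma lifts_laurent x y : lifts 0 x y -> exists L, x = qX_eval omega M T L.
Proof.
case=> s [hs -> _].
suff [s' ->] : exists s' : seq (int * (vec N * int)),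
    \sum_(t <- s) t.1%:~R * (omega ^ (4 * t.2.2) * M T t.2.1) =
    \sum_(t <- s') t.1%:~R * (omega ^ (4 * t.2.2) *
      \prod_(j in internal T) qX M T j ^ t.2.1 j).
  by have [L <-] := qX_eval_seq s'; exists L.
elim: s hs => [|t s IH] hs; first by exists [::]; rewrite !big_nil.
have [|s' Es'] := IH; first by move=> t' ts; apply: hs; rewrite inE ts orbT.
have [hu du] := hs t (mem_head _ _).
(* The exponent, of degree 0, becomes a combination of X-vectors; the shift by [k] absorbs the power
   of q from [prod_qX]. *)
have [n En] := deg0_span hT hu du; have [k Ek] := prod_qX n.
exists ((t.1, (n, t.2.2 - k)) :: s'); rewrite !big_cons Es' /=; congr (_ * _ + _).
rewrite Ek mulrA -(omegaD hF hM) En; congr (omega ^ _ * _); ring.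
Qed.

(** The difference of two expansions of [x] is a relation between torus monomials, and [torus_free]
    carries it over to the classical monomials. *)
Lemma lifts_uniq d d' x y y' : lifts d x y -> lifts d' x y' -> y = y'.
Proof.
case=> s [hs -> ->] [s' [hs' E ->]].
pose r := [seq (t.1, (t.2.1, 4 * t.2.2)) | t <- s] ++
          [seq (- t.1, (t.2.1, 4 * t.2.2)) | t <- s'].
apply/eqP; rewrite -subr_eq0; apply/eqP.
have <- : \sum_(t <- r) t.1%:~R * monomial A T t.2.1 =
    \sum_(t <- s) t.1%:~R * monomial A T t.2.1 -
    \sum_(t <- s') t.1%:~R * monomial A T t.2.1.
  rewrite big_cat !big_map; congr (_ + _); rewrite -sumrN.
  by apply: eq_bigr => t _; rewrite mulrNz mulNr.
apply: (torus_free hM hT _ _ (fun m => monomial A T m.1)) => [t|].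
  by rewrite mem_cat => /orP[]/mapP[t' ts ->]; [case: (hs _ ts)|case: (hs' _ ts)].
rewrite big_cat !big_map /= E -big_split big1 //= => t _.
by rewrite mulrNz mulNr addrN.
Qed.

(** Identifies the specialization of [L] at q = 1 as the classical value attached to its quantum
    evaluation. *)
Lemma lifts_qX_eval L :
  lifts 0 (qX_eval omega M T L)
    (\sum_(m <- finsupp L) (L m)%:~R *
      \prod_(j in internal T) (\prod_(s in T) A s ^ eps T j s) ^ m.1 j).
Proof.
apply: lifts_sum => m _; rewrite -mulrA; apply: lifts_int.
have [k ->] := prod_qX m.1; rewrite mulrA /qparam exprnP exprz_exp -(omegaD hF hM).
have -> : \prod_(j in internal T) (\prod_(s in T) A s ^ eps T j s) ^ m.1 j =
    monomial A T (X_sum m.1).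
  rewrite /X_sum; elim/big_rec2: _ => [|j a u jT ->]; first by rewrite monomial0.
  rewrite monomialD // monomialMz //; congr (_ ^ _ * _).
  by apply: eq_bigr => s sT; rewrite sum_basis_vec sT.
rewrite -(deg_X_sum m.1); apply: lifts_omega => //; last exact/lifts_M/X_sum_supported.
by rewrite -mulrDr dvdz_mulr.
Qed.

Hypothesis hP : ptolemy A.

(** Arcs of [T] may be inverted; the others have nonnegative exponents, so products of their
    expansions suffice. *)
Lemma lifts_vec_nonneg T' w : ideal_triangulation T' -> supported T' w ->
  (forall i, i \in T' -> i \notin T -> 0 <= w i) ->
  lifts_vec omega M A T T' w (\prod_(i in T') A i ^ w i).
Proof.
move=> hT' hw wpos; rewrite {1}(vec_sum_basis hw).
have lD := lifts_vecD hF hM hT hA hT'.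
have l0 := lifts_vec0 hM A hT hT'.
apply: (big_rec2 (lifts_vec omega M A T T')) => [//|i a u iT' h]; apply: (lD) => //.
have ln (v : vec N) y (n : nat) : lifts_vec omega M A T T' v y ->
    lifts_vec omega M A T T' (v *~ n) (y ^+ n).
  move=> hv; elim: n => [|n IH]; first by rewrite mulr0z expr0.
  by rewrite intS mulrzDr mulr1z exprS; apply: (lD).
have [iT|niT] := boolP (i \in T); last first.
  have := wpos i iT' niT; case: (w i) => // n _.
  by apply/ln/lifts_arc.
case: (w i) => n; first by apply/ln/lifts_arc.
rewrite NegzE mulrNz -mulNrz -exprnN -exprVn.
by apply/ln/lifts_vec_basisN.
Qed.

End Fixed.
End Laurent.

(** * Laminations *)

Section Laminations.
Variables (N : nat) (l : lamination N).
Implicit Types (i j k : ideal_arc N) (c : curve N) (T : {set ideal_arc N}).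

Definition in_block (p r e : nat) : bool := (p <= e < r)%N.

(* Half the weight of the curves joining the boundary edges [p, ..., r - 1] to
   the other ones. *)
Definition cut (p r : nat) : rat :=
  2^-1 * \sum_c (in_block p r (src c) != in_block p r (tgt c))%:R * weight l c.

Lemma a_coordE i : a_coord (weight l) i = cut (src i).+1 (tgt i).+1.
Proof.
rewrite /a_coord /cut big_mkcond; congr (_ * _); apply: eq_bigr => c _.
rewrite /crosses_edge /edge_side /in_block ltnS.
by case: ifP => _; rewrite ?mul1r ?mul0r.
Qed.

(* The boundary edges fall into four blocks; curves joining blocks 1 and 3 cross
   those joining blocks 2 and 4, so that one of the two kinds has weight 0. *)
Lemma a_coord_ptolemy (w x y z : 'I_N) (wx : (w < x)%N) (xy : (x < y)%N)
    (yz : (y < z)%N) (wz : (w < z)%N) (wy : (w < y)%N) (xz : (x < z)%N) :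
  let a k := a_coord (weight l) k in
  a (chord wy) + a (chord xz) = a (chord wx) + a (chord yz) \/
  a (chord wy) + a (chord xz) = a (chord xy) + a (chord wz).
Proof.
(* The boundary edge [e] ends at the marked point [e], so those between the marked points [w] and
   [x] have labels [w + 1] to [x]. The block [B4] consists of the edges outside the first three. *)
pose B1 (e : nat) := in_block w.+1 x.+1 e.
pose B2 (e : nat) := in_block x.+1 y.+1 e.
pose B3 (e : nat) := in_block y.+1 z.+1 e.
pose B4 (e : nat) := ~~ in_block w.+1 z.+1 e.
pose J24 c := (B2 (src c) && B4 (tgt c)) || (B4 (src c) && B2 (tgt c)).
pose J13 c := (B1 (src c) && B3 (tgt c)) || (B3 (src c) && B1 (tgt c)).
have J_cross c c' : J24 c -> J13 c' -> cross c c'.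
  rewrite /J24 /J13 /B1 /B2 /B3 /B4 /in_block crossE.
  have := src_lt_tgt c; have := src_lt_tgt c'; clear -wx xy yz; lia.
(* The curves of [J] cross both diagonals and neither of the two chosen opposite sides; for all
   other curves the two counts agree. *)
have sumE (s1 s2 t1 t2 : curve N -> bool) (J : curve N -> bool) :
    (forall c, J c -> weight l c = 0) ->
    (forall c, s1 c + s2 c = t1 c + t2 c + J c + J c)%N ->
    2^-1 * (\sum_c (s1 c)%:R * weight l c) + 2^-1 * (\sum_c (s2 c)%:R * weight l c) =
    2^-1 * (\sum_c (t1 c)%:R * weight l c) + 2^-1 * (\sum_c (t2 c)%:R * weight l c).
  move=> J0 hJ; rewrite -!mulrDr -!big_split; congr (_ * _).
  apply: eq_bigr => c _ /=; rewrite -!mulrDl -!natrD hJ -addnA natrD mulrDl.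
  case: (J c) (J0 c) => [->//|_]; by rewrite ?mulr0 ?addr0 // addn0 mul0r addr0.
rewrite /= !a_coordE /cut !src_chord !tgt_chord.
have [/existsP[c /andP[Jc wc]]|none] := boolP [exists c, J24 c && (weight l c != 0)].
  right; apply: (sumE _ _ _ _ J13) => c'.
    move=> Jc'; apply/eqP; apply: contraTT (J_cross _ _ Jc Jc') => wc'.
    exact: (lam_disjoint wc wc').
  rewrite /J13 /B1 /B3 /in_block.
  have := src_lt_tgt c'; clear -wx xy yz; lia.
left; apply: (sumE _ _ _ _ J24) => c.
  move=> Jc; apply/eqP; move/existsPn/(_ c): none.
  by rewrite Jc negbK.
rewrite /J24 /B2 /B4 /in_block.
have := src_lt_tgt c; clear -wx xy yz; lia.
Qed.

(** Integrality, given on one triangulation, spreads to every arc through the tropical Ptolemy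
    relation. *)
Lemma a_coord_int i : a_coord (weight l) i \is a Num.int.
Proof.
have [T hT intT] := lam_int l; move: i; apply: (arc_ind hT intT).
move=> w x y z wx xy yz wz wy xz i1 i2 i3 i4.
have := a_coord_ptolemy wx xy yz wz wy xz => /= ptol.
have step (a b c d : rat) : a + b = c + d -> c \is a Num.int -> d \is a Num.int ->
    (a \is a Num.int -> b \is a Num.int) /\ (b \is a Num.int -> a \is a Num.int).
  move=> e hc hd; split=> h.
    have -> : b = c + d - a by rewrite -e addrC addKr.
    by rewrite rpredB ?rpredD.
  have -> : a = c + d - b by rewrite -e addrK.
  by rewrite rpredB ?rpredD.
have {}step : (a_coord (weight l) (chord wy) \is a Num.int ->
    a_coord (weight l) (chord xz) \is a Num.int) /\
   (a_coord (weight l) (chord xz) \is a Num.int ->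
    a_coord (weight l) (chord wy) \is a Num.int).
  by case: ptol => e; apply: step e _ _.
by split=> /intT; case: step; auto.
Qed.

Lemma cut_int (p r : nat) : (p <= r)%N -> (r <= N)%N -> cut p r \is a Num.int.
Proof.
move=> pr rN; have int_arc (e f : nat) : (e < f)%N -> (f < N)%N ->
    cut e.+1 f.+1 \is a Num.int.
  move=> ef fN; have eN := ltn_trans ef fN.
  have ef' : (Ordinal eN < Ordinal fN)%N by [].
  by have := a_coord_int (chord ef'); rewrite a_coordE.
have cut_triv (p' r' : nat) :
    (forall c, in_block p' r' (src c) = in_block p' r' (tgt c)) -> cut p' r' = 0.
  by move=> h; rewrite /cut big1 ?mulr0 // => c _; rewrite h eqxx mul0r.
have lN c : (src c < N)%N && (tgt c < N)%N by rewrite !ltn_ord.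
have [e|npr] := eqVneq p r.
  by rewrite cut_triv // => c; rewrite /in_block e; clear; lia.
case: p => [|p] in pr npr *; last first.
  by case: r => [|r] in pr npr rN *; [|apply: int_arc]; clear -pr npr rN; lia.
have [e|nrN] := eqVneq r N.
  by rewrite cut_triv // => c; rewrite /in_block e; move: (lN c); clear; lia.
case: r => [|r] in pr npr rN nrN *; first by [].
(* A block starting at the boundary edge 0 is not the [edge_side] of an arc, but its complement is,
   and both have the same cut. *)
have -> : cut 0 r.+1 = cut r.+1 N.
  rewrite /cut; congr (_ * _); apply: eq_bigr => c _; congr (_%:R * _).
  by rewrite /in_block; move: (lN c); clear; lia.
have N0 : (0 < N)%N by clear -rN; lia.
rewrite -(prednK N0); apply: int_arc; clear -rN nrN npr N0; lia.
Qed.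

(** A second difference of cuts isolates the curves joining the boundary edges [src c] and [tgt c].
    Each is counted twice, which compensates the factor one half; integrality of the weights
    follows. *)
Lemma weight_cut c : weight l c = cut (src c) (tgt c) + cut (src c).+1 (tgt c).+1
  - cut (src c) (tgt c).+1 - cut (src c).+1 (tgt c).
Proof.
pose X p r (c' : curve N) := in_block p r (src c') != in_block p r (tgt c').
have key c' : (X (src c) (tgt c) c' + X (src c).+1 (tgt c).+1 c' =
   X (src c) (tgt c).+1 c' + X (src c).+1 (tgt c) c' + (c' == c) + (c' == c))%N.
  rewrite /X /in_block arc_eqE.
  have := src_lt_tgt c; have := src_lt_tgt c'; clear; lia.
rewrite /cut -!mulrDr -!mulrBr -big_split -!sumrB.
transitivity (2^-1 * (\sum_(c' | c' == c) (weight l c + weight l c))).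
  by rewrite big_pred1_eq; field.
congr (_ * _); rewrite big_mkcond; apply: eq_bigr => c' _ /=.
rewrite -mulrDl -!mulrBl -natrD (key c') !natrD /X.
by case: (eqVneq c' c) => [->|_] /=; ring.
Qed.

Lemma weight_int c : weight l c \is a Num.int.
Proof.
have lc := src_lt_tgt c; have lN := ltn_ord (tgt c).
by rewrite weight_cut !rpredB ?rpredD // cut_int //; clear -lc lN; lia.
Qed.

Definition lam_vec : vec N := [ffun c => numq (weight l c)].

Lemma lam_vecE c : (lam_vec c)%:~R = weight l c.
Proof. by rewrite ffunE numqK ?weight_int. Qed.

(** A sigma type, so that the map on laminations can be defined from the chosen triangulation. *)
Lemma adapted_ex : {T | adapted l T lam_vec}.
Proof.
have nc : noncrossing [set c | weight l c != 0].
  by apply/noncrossingP => c c'; rewrite !inE; apply: lam_disjoint.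
have [T hT /subsetP sT] := tri_ex nc; exists T; split=> //.
- by move=> c wc; apply: sT; rewrite inE.
- by move=> c; rewrite -(intr_eq0 rat) lam_vecE => wc; apply: sT; rewrite inE.
- exact: lam_vecE.
Qed.

Section Adapted.
Variables (T : {set ideal_arc N}) (w : vec N).
Hypothesis hw : adapted l T w.

Lemma adapted_vec : w = lam_vec.
Proof.
have [_ _ _ wE] := hw; apply/ffunP => c; apply: (@intr_inj rat).
by rewrite lam_vecE; apply: wE.
Qed.

(** Special curves are dragged to boundary edges, which belong to every triangulation; all other
    weights are nonnegative. *)
Lemma adapted_ge0 T' i : ideal_triangulation T' -> i \notin T' -> 0 <= w i.
Proof.
have [_ _ _ wE] := hw; move=> hT' niT'; rewrite -(ler0z rat) (wE i).
by apply: lam_ge0; apply: contra niT'; apply: tri_adjacent.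
Qed.

(** The curves with an end on the boundary edge [p] become the arcs ending at the marked point [p],
    where the total weight of ends is 0. *)
Lemma adapted_deg : deg w = 0.
Proof.
have [_ _ _ wE] := hw; apply/ffunP => p; rewrite ffunE [RHS]ffunE.
apply: (@intr_inj rat); rewrite rmorph_sum -[RHS](lam_ends l p) [RHS]big_mkcond.
apply: eq_bigr => c _; rewrite rmorphM /= wE rmorphD /= !rmorph_nat /curve_end.
have := src_lt_tgt c; rewrite ![p == _]eq_sym -/(src c) -/(tgt c).
have [->|] := eqVneq (src c) p; have [->|] := eqVneq (tgt c) p => //=.
- by rewrite ltnn.
- by rewrite addr0 mulr1.
- by rewrite add0r mulr1.
- by rewrite addr0 mulr0.
Qed.

End Adapted.
End Laminations.

(** * Solutions of the Ptolemy relations, and the duality map *)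

Lemma A_coordE (N : nat) (C : fieldType) (v : 'I_N -> 'cV[C]_2) (i : ideal_arc N) :
  A_coord v i = v (src i) 0 0 * v (tgt i) 1 0 - v (tgt i) 0 0 * v (src i) 1 0.
Proof.
have det2 (B : 'M[C]_2) : \det B = B 0 0 * B 1 1 - B 0 1 * B 1 0.
  rewrite (expand_det_row _ 0) !big_ord_recl big_ord0 /cofactor !det_mx11 !mxE.
  have -> : lift (0 : 'I_2) 0 = 1 by apply: val_inj.
  have -> : lift (1 : 'I_2) 0 = 0 by apply: val_inj.
  by rewrite /= !expr0 !expr1 addr0 !mul1r mulN1r mulrN.
rewrite /A_coord det2.
have E0 (a b : 'cV[C]_2) k : (row_mx a b : 'M[C]_2) k 0 = a k 0.
  by rewrite -(row_mxEl a b k 0); congr (row_mx a b k _); apply: val_inj.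
have E1 (a b : 'cV[C]_2) k : (row_mx a b : 'M[C]_2) k 1 = b k 0.
  by rewrite -(row_mxEr a b k 0); congr (row_mx a b k _); apply: val_inj.
by rewrite !E0 !E1.
Qed.

Lemma ptolemy_A_coord (N : nat) (C : fieldType) (v : 'I_N -> 'cV[C]_2) :
  ptolemy (A_coord v).
Proof.
move=> p q r s pq qr rs ps pr qs; rewrite !A_coordE !src_chord !tgt_chord; ring.
Qed.

(* Any nowhere vanishing solution of the Ptolemy relations will do to apply the
   lemmas on [lifts] when only the quantum side matters. *)
Definition arc_length (N : nat) (i : ideal_arc N) : rat := (tgt i)%:R - (src i)%:R.

Lemma ptolemy_arc_length (N : nat) : ptolemy (@arc_length N).
Proof.
by move=> p q r s pq qr rs ps pr qs; rewrite /arc_length !src_chord !tgt_chord; ring.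
Qed.

Lemma arc_length_neq0 (N : nat) (i : ideal_arc N) : arc_length i != 0.
Proof. by rewrite subr_eq0 eqr_nat gtn_eqF // src_lt_tgt. Qed.

Theorem theorem1p2p6 (N : nat) (hN : (2 < N)%N)
    (F : unitRingType) (hF : GRing.field_axiom F) (omega : F)
    (M : {set ideal_arc N} -> vec N -> F) (hM : toric_frames omega M) :
  exists Iq : lamination N -> {x : F | in_Oq omega M x},
    forall l : lamination N,
      (exists Tl : {set ideal_arc N}, exists w : vec N, adapted l Tl w) /\
      (forall (Tl : {set ideal_arc N}) (w : vec N), adapted l Tl w ->
         sval (Iq l) = M Tl w /\
         forall (T : {set ideal_arc N}) (L : laurent N), ideal_triangulation T ->
           sval (Iq l) = qX_eval omega M T L ->
           forall (R : realType) (v : 'I_N -> 'cV[R[i]]_2),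
             (forall s : ideal_arc N, s \in T -> A_coord v s != 0) ->
             cX_eval v T L = cI v Tl w).
Proof.
have lift (C : fieldType) (A : ideal_arc N -> C) l Tl w T : adapted l Tl w ->
    ideal_triangulation T -> {in T, forall i, A i != 0} -> ptolemy A ->
    lifts omega M A T 0 (M Tl w) (\prod_(i in Tl) A i ^ w i).
  move=> hw hT hA hP; have [hTl _ sw _] := hw.
  rewrite -(adapted_deg hw).
  have [] // := lifts_vec_nonneg hF hM hT hA hP hTl sw.
  by move=> i _; apply: (adapted_ge0 hw hT).
have Oq l Tl w : adapted l Tl w -> in_Oq omega M (M Tl w).
  move=> hw; have laurent T : ideal_triangulation T ->
      exists L, M Tl w = qX_eval omega M T L.
    move=> hT; apply: (lifts_laurent hF hM hT).
    apply: lift hw hT _ (@ptolemy_arc_length N) => i _; exact: arc_length_neq0.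
  split=> //; have [hTl _ _ _] := hw; have [L ->] := laurent _ hTl.
  exact: qX_eval_in_Xq.
(* The image is taken in the triangulation provided by [adapted_ex]. *)
exists (fun l => exist _ _ (Oq _ _ _ (proj2_sig (adapted_ex l)))) => l.
case: (adapted_ex l) => T0 h0 /=; split; first by exists T0, (lam_vec l).
move=> Tl w hw; have [hT0 _ s0 _] := h0; have [hTl _ sw _] := hw.
have ew := adapted_vec hw.
have EM : M T0 (lam_vec l) = M Tl w.
  by rewrite ew; apply: (M_indep_triangulation hF hM) => //; rewrite -ew.
split=> // T L hT EL R v hv; rewrite EM in EL.
(* The same quantum element has two classical values, one from expanding the arcs of [Tl] in [T] and
   one from [L] at q = 1; uniqueness equates them. *)
have l1 := lift _ _ _ _ _ _ hw hT hv (ptolemy_A_coord v).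
have := lifts_qX_eval hF hM hT hv L; rewrite -EL => l2.
exact (lifts_uniq hM hT l2 l1).
Qed.
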